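(* Let $\mathfrak{A}$ be a finite algebra with $|A|\geq2$ such that for no $n\geq1$ is there a subalgebra of $\mathfrak{A}^n$ whose universe belongs to Rosenberg's list. Then $\mathfrak{A}$ has minimal spectrum, i.e. the set of cardinalities of finite members of the variety generated by $\mathfrak{A}$ is exactly $\{|A|^n:n\geq0\}$.
   Context: Rosenberg's list consists of the following relations on $A$: (1) partial orders with least and greatest element; (2) graphs of prime permutations of $A$ (all cycles of the same prime length); (3) equivalence relations other than the diagonal and $A^2$; (4) relations $\{(a,b,c,d):a+b=c+d\}$ for an abelian group $(A,+)$ whose non-zero elements all have the same prime order; (5) central relations: $h$-ary ($h\ge1$), totally reflexive (containing every tuple with two equal coordinates), totally symmetric (invariant under coordinate permutations), with center $\{a:\forall a_2,\dots,a_h\ (a,a_2,\dots,a_h)\in\rho\}$ non-empty and a proper subset of $A$; (6) for $3\le h\le|A|$, $h$-regularly generated relations $\{(x_1,\dots,x_h):(\varphi(x_1),\dots,\varphi(x_h))\in\omega_\lambda\}$, where $\lambda\ge1$, $\varphi:A\to\{0,\dots,h-1\}^\lambda$ is surjective and $\omega_\lambda$ consists of the $h$-tuples of $\{0,\dots,h-1\}^\lambda$ whose $r$-th coordinates are not pairwise distinct for every $1\le r\le\lambda$. *)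

(* Defs.v *)
From HB Require Import structures.
From mathcomp Require Import all_boot all_order all_fingroup.
From mathcomp Require boolp.

Set Implicit Arguments.
Unset Strict Implicit.
Unset Printing Implicit Defensive.

Record signature := Signature { symbol : Type; arity : symbol -> nat }.

(* Universes of algebras are non-empty, as usual in universal algebra; without *)
(* this, 0 would be a cardinality in the spectrum of any algebra lacking       *)
(* nullary operations.                                                         *)
Record algebra (S : signature) := Algebra {
  carrier :> Type;
  op : forall o : symbol S, (arity o).-tuple carrier -> carrier;
  carrier_nonempty : inhabited carrier
}.

Record finAlgebra (S : signature) := FinAlgebra {
  fcarrier : finType;
  fop : forall o : symbol S, (arity o).-tuple fcarrier -> fcarrier;
  fcarrier_nonempty : inhabited fcarrier
}.

Coercion algebra_of_fin (S : signature) (A : finAlgebra S) : algebra S :=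
  Algebra (@fop S A) (fcarrier_nonempty A).

Definition hom (S : signature) (B C : algebra S) (f : B -> C) : Prop :=
  forall (o : symbol S) (t : (arity o).-tuple B),
    f (op t) = op (map_tuple f t).

Definition subuniverse (S : signature) (B : algebra S) (P : B -> Prop) : Prop :=
  (exists x, P x) /\
  forall (o : symbol S) (t : (arity o).-tuple B),
    (forall i, P (tnth t i)) -> P (op t).

Lemma inhabited_prod (I : Type) (T : I -> Type) :
  (forall i, inhabited (T i)) -> inhabited (forall i, T i).
Proof.
move=> nT; have nT' i : exists _ : T i, True by case: (nT i) => x; exists x.
exact: (inhabits (fun i => projT1 (boolp.cid (nT' i)))).
Qed.

Definition prod_algebra (S : signature) (I : Type) (B : I -> algebra S) :
    algebra S :=
  @Algebra S (forall i, B i)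
    (fun o t i => op (map_tuple (fun x : forall j, B j => x i) t))
    (inhabited_prod (fun i => carrier_nonempty (B i))).

Lemma inhabited_tuple (T : Type) (n : nat) :
  inhabited T -> inhabited (n.-tuple T).
Proof. by case=> x; exact: (inhabits (nseq_tuple n x)). Qed.

Definition power_algebra (S : signature) (B : algebra S) (n : nat) :
    algebra S :=
  @Algebra S (n.-tuple B)
    (fun o t =>
       [tuple op (map_tuple (fun x : n.-tuple B => tnth x j) t) | j < n])
    (inhabited_tuple n (carrier_nonempty B)).

Definition surjective (T U : Type) (f : T -> U) : Prop :=
  forall y, exists x, f x = y.

(* Closure under subalgebras is stated up to isomorphism, via embeddings. *)
Definition is_variety (S : signature) (K : algebra S -> Prop) : Prop :=
  [/\ forall (B C : algebra S) (f : B -> C),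
        hom f -> surjective f -> K B -> K C,
      forall (B C : algebra S) (f : B -> C),
        hom f -> injective f -> K C -> K B
    & forall (I : Type) (B : I -> algebra S),
        (forall i, K (B i)) -> K (prod_algebra B)].

Definition generated_variety (S : signature) (A B : algebra S) : Prop :=
  forall K : algebra S -> Prop, is_variety K -> K A -> K B.

Definition has_card (T : Type) (m : nat) : Prop :=
  exists f : T -> 'I_m, bijective f.

Definition spectrum (S : signature) (A : algebra S) (m : nat) : Prop :=
  exists B : algebra S, generated_variety A B /\ has_card B m.

Definition minimal_spectrum (S : signature) (A : finAlgebra S) : Prop :=
  forall m : nat, spectrum A m <-> exists n : nat, m = #|fcarrier A| ^ n.

Section RosenbergList.

Variable A : finType.

Definition graph2 (r : rel A) : {set 2.-tuple A} :=
  [set t | r (tnth t ord0) (tnth t ord_max)].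

Definition bounded_order (le : rel A) : Prop :=
  [/\ reflexive le, antisymmetric le, transitive le,
      exists bot, forall x, le bot x
    & exists top, forall x, le x top].

Definition prime_perm (s : {perm A}) : Prop :=
  exists p, prime p /\ forall x, #|porbit s x| = p.

Definition nontrivial_equivalence (e : rel A) : Prop :=
  [/\ reflexive e, symmetric e, transitive e,
      graph2 e <> graph2 eq_op
    & graph2 e <> setT].

Definition abelian_group (add : A -> A -> A) (zero : A) (opp : A -> A) : Prop :=
  [/\ associative add, commutative add, left_id zero add
    & left_inverse zero opp add].

Definition has_order (add : A -> A -> A) (zero x : A) (p : nat) : Prop :=
  [/\ 0 < p, iter p (add x) zero = zero
    & forall k, 0 < k < p -> iter k (add x) zero <> zero].

Definition elementary_abelian
    (add : A -> A -> A) (zero : A) (opp : A -> A) : Prop :=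
  abelian_group add zero opp /\
  exists p, prime p /\ forall x, x <> zero -> has_order add zero x p.

Definition affine_rel (add : A -> A -> A) : {set 4.-tuple A} :=
  [set t | add (tnth t (inord 0)) (tnth t (inord 1))
           == add (tnth t (inord 2)) (tnth t (inord 3))].

Definition totally_reflexive (h : nat) (rho : {set h.-tuple A}) : Prop :=
  forall t : h.-tuple A, ~~ uniq t -> t \in rho.

Definition totally_symmetric (h : nat) (rho : {set h.-tuple A}) : Prop :=
  forall (s : 'S_h) (t : h.-tuple A),
    t \in rho -> [tuple tnth t (s i) | i < h] \in rho.

Definition center (h : nat) (rho : {set h.+1.-tuple A}) : {set A} :=
  [set a | [forall u : h.-tuple A, cons_tuple a u \in rho]].

Definition central (h : nat) (rho : {set h.+1.-tuple A}) : Prop :=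
  [/\ totally_reflexive rho, totally_symmetric rho,
      center rho <> set0
    & center rho \proper [set: A]].

Definition omega (h l : nat) : {set h.-tuple (l.-tuple 'I_h)} :=
  [set u : h.-tuple (l.-tuple 'I_h) |
     [forall r : 'I_l, ~~ uniq [seq tnth y r | y : l.-tuple 'I_h <- u]]].

Definition regularly_generated (h l : nat) (phi : A -> l.-tuple 'I_h) :
    {set h.-tuple A} :=
  [set t : h.-tuple A | map_tuple phi t \in omega h l].

Inductive rosenberg : forall h : nat, {set h.-tuple A} -> Prop :=
| rosenberg_order (le : rel A) :
    bounded_order le -> rosenberg (graph2 le)
| rosenberg_perm (s : {perm A}) :
    prime_perm s -> rosenberg (graph2 (fun x y => s x == y))
| rosenberg_equiv (e : rel A) :
    nontrivial_equivalence e -> rosenberg (graph2 e)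
| rosenberg_affine (add : A -> A -> A) (zero : A) (opp : A -> A) :
    elementary_abelian add zero opp -> rosenberg (affine_rel add)
| rosenberg_central (h : nat) (rho : {set h.+1.-tuple A}) :
    central rho -> rosenberg rho
| rosenberg_regular (h l : nat) (phi : A -> l.-tuple 'I_h) :
    3 <= h <= #|A| -> 1 <= l -> surjective phi ->
    rosenberg (regularly_generated phi).

End RosenbergList.

(* Main.v *)
Require Import Defs.
From mathcomp Require Import all_boot all_order all_fingroup.
From mathcomp Require Import cyclic boolp.

Set Implicit Arguments.
Unset Strict Implicit.
Unset Printing Implicit Defensive.

(* Every invariant relation of A is defined by equalities between coordinates, *)
(* so that finite members of the variety, being quotients of finite subpowers, *)
(* are powers of A.                                                            *)
(*                                                                             *)
(* First, A has no invariant totally reflexive symmetric relation of arity     *)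
(* h >= 3 other than the full one. Take h maximal and such a rho maximal.      *)
(* Maximality of h gives a Helly principle: an invariant relation containing   *)
(* all tuples with at most h values is full. Hence, as rho is not central, it  *)
(* is homogeneous (x is in rho as soon as, for some u, all replacements of a   *)
(* coordinate of x by u are), and the identity is t(d_s(y_s(a)))_s for a term  *)
(* operation t and maps y_s into h-element ranges. Homogeneity isolates the    *)
(* arguments r on which membership in rho depends. A rho-preserving unary map  *)
(* p, nontrivial and of least image, has only one such argument r in p(t(..)), *)
(* so y_r is an h-colouring of A whose rainbow tuples avoid rho; such          *)
(* colourings separate tuples from rho, and the relevant coordinates y_r of t  *)
(* exhibit rho as regularly generated.                                         *)
(*                                                                             *)
(* Now the Helly principle holds with h = 2. A binary relation is the equality *)
(* or full, since otherwise a permutation, an equivalence, a central relation  *)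
(* or a bounded order is invariant. A nontrivial relation of least arity has   *)
(* arity 3 or 4 and yields an invariant relation behaving like y - x = t - z,  *)
(* which is affine.                                                            *)

(** * Invariant relations and polymorphisms *)

(** The core is rigidity ([inv_diagonal]): a tuple belongs to a non-empty invariant relation as soon
    as it satisfies the equalities between coordinates valid throughout that relation. In
    [spectrum_power], a member with m elements is a quotient of the free algebra on m generators,
    which sits in the power of A indexed by the evaluations of the generators. The kernel is an
    invariant relation on two copies of these coordinates, so by rigidity it is agreement on a set Y
    of coordinates, and the member is the power of A indexed by Y. Rigidity follows by induction on
    the arity ([free_full], [arity_step]) from three exclusions: [no_spread] (central and regularly
    generated relations), [binary_full] (permutations, equivalences, central relations, orders) and
    [no_parallelogram] (affine relations). *)

Section Invariants.

Variables (S : signature) (A : finAlgebra S).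
Local Notation T := (fcarrier A).

Definition opf (o : symbol S) (x : 'I_(arity o) -> T) : T :=
  fop [tuple x i | i < arity o].

(* Relations are predicates on families of elements indexed by an arbitrary *)
(* type, so that substitution of variables is composition.                  *)
Definition inv (X : Type) (R : (X -> T) -> Prop) : Prop :=
  forall (o : symbol S) (t : 'I_(arity o) -> X -> T),
    (forall i, R (t i)) -> R (fun x => opf (fun i => t i x)).

Definition inv2 (R : T -> T -> Prop) : Prop :=
  forall (X : Type) (i j : X), inv (fun x : X -> T => R (x i) (x j)).

Definition inv3 (R : T -> T -> T -> Prop) : Prop :=
  forall (X : Type) (i j k : X), inv (fun x : X -> T => R (x i) (x j) (x k)).

Definition inv4 (R : T -> T -> T -> T -> Prop) : Prop :=
  forall (X : Type) (i j k l : X),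
    inv (fun x : X -> T => R (x i) (x j) (x k) (x l)).

Lemma inv_and (X : Type) (P Q : (X -> T) -> Prop) :
  inv P -> inv Q -> inv (fun x => P x /\ Q x).
Proof.
by move=> hP hQ o t h; split; [apply: hP | apply: hQ] => i; case: (h i).
Qed.

Lemma inv_forall (X : Type) (I : Type) (P : I -> (X -> T) -> Prop) :
  (forall i, inv (P i)) -> inv (fun x => forall i, P i x).
Proof. by move=> hP o t h i; apply: hP => j; apply: h. Qed.

Lemma inv_comp (X Y : Type) (R : (Y -> T) -> Prop) (f : Y -> X) :
  inv R -> inv (fun x => R (fun y => x (f y))).
Proof. by move=> hR o t h; apply: (hR o (fun i y => t i (f y))). Qed.

Lemma inv_eq (X : Type) (i j : X) : inv (fun x : X -> T => x i = x j).
Proof. by move=> o t h; congr opf; apply/funext. Qed.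

Lemma inv_ex1 (X : Type) (P : (X -> T) -> T -> Prop) :
  inv (fun z : option X -> T => P (fun x => z (Some x)) (z None)) ->
  inv (fun x => exists u, P x u).
Proof.
move=> hP o t /choice [y hy]; exists (opf y).
pose w i (c : option X) := if c is Some a then t i a else y i.
exact: (hP o w).
Qed.

Lemma inv_image (X Y : Type) (R : (X -> T) -> Prop) (f : Y -> X) :
  inv R -> inv (fun y => exists2 x, R x & y = (fun b => x (f b))).
Proof.
move=> hR o t h.
have /choice [x hx] : forall i, exists x, R x /\ t i = (fun b => x (f b)).
  by move=> i; case: (h i) => x; exists x.
exists (fun a => opf (fun i => x i a)).
  by apply: hR => i; case: (hx i).
by apply/funext => b; congr opf; apply/funext => i; case: (hx i) => _ ->.
Qed.

(** The term operations of A, described semantically through the relations that they preserve. *)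
Definition pol (I : Type) (f : (I -> T) -> T) : Prop :=
  forall (X : Type) (R : (X -> T) -> Prop), inv R ->
  forall x : I -> X -> T, (forall i, R (x i)) ->
    R (fun a => f (fun i => x i a)).

Lemma pol_proj (I : Type) (i : I) : pol (fun x : I -> T => x i).
Proof. by move=> X R _ x h; apply: h. Qed.

Lemma pol_op (I : Type) (o : symbol S) (f : 'I_(arity o) -> (I -> T) -> T) :
  (forall i, pol (f i)) -> pol (fun x => opf (fun i => f i x)).
Proof.
move=> hf X R hR x h; apply: (hR o (fun i a => f i (fun j => x j a))) => i.
exact: hf.
Qed.

Inductive gen (X : Type) (G : (X -> T) -> Prop) : (X -> T) -> Prop :=
| gen_in x : G x -> gen G x
| gen_op o (t : 'I_(arity o) -> X -> T) :
    (forall i, gen G (t i)) -> gen G (fun x => opf (fun i => t i x)).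

Lemma gen_inv (X : Type) (G : (X -> T) -> Prop) : inv (gen G).
Proof. by move=> o t; apply: gen_op. Qed.

(** Each argument of an operation comes with its own finite family of generators; their dependent
    sum indexes the arguments of f. *)
Lemma gen_pol (X : Type) (G : (X -> T) -> Prop) (x : X -> T) : gen G x ->
  exists (I : finType) (f : (I -> T) -> T) (g : I -> X -> T),
    [/\ pol f, forall i, G (g i) & x = fun a => f (fun i => g i a)].
Proof.
elim=> [{}x hx|o t _ IH].
  by exists unit, (fun y => y tt), (fun _ => x); split=> //; apply: pol_proj.
have /choice [I hI] := IH.
pose f i := projT1 (cid (hI i)); pose hf i := projT2 (cid (hI i)).
pose g i := projT1 (cid (hf i)).
have hg i : [/\ pol (f i), forall j, G (g i j)
              & t i = fun a => f i (fun j => g i j a)].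
  exact: projT2 (cid (hf i)).
exists {i : 'I_(arity o) & I i},
  (fun y => opf (fun i => f i (fun j => y (existT _ i j)))),
  (fun c => g (projT1 c) (projT2 c)); split.
- apply: pol_op => i X' R hR x' h'; case: (hg i) => hp _ _.
  exact: (hp X' R hR (fun j => x' (existT _ i j))).
- by case=> i j /=; case: (hg i).
- apply/funext => a; congr opf; apply/funext => i.
  by case: (hg i) => _ _ ->.
Qed.

Definition rosenberg_free : Prop :=
  forall (n : nat) (rho : {set n.-tuple T}), 1 <= n ->
    @subuniverse S (power_algebra A n) (fun x : n.-tuple T => x \in rho) ->
    ~ rosenberg rho.

Hypothesis hrho : rosenberg_free.

Lemma inv_not_rosenberg (n : nat) (rho : {set n.-tuple T}) : 0 < n ->
  (exists t, t \in rho) ->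
  inv (fun x : 'I_n -> T => [tuple x i | i < n] \in rho) -> ~ rosenberg rho.
Proof.
move=> n_gt0 ne h; apply: hrho => //; split=> // o t ht.
have /= := h o (fun i j => tnth (tnth t i) j).
have e (i : 'I_(arity o)) :
    [tuple tnth (tnth t i) j | j < n] = tnth t i :> n.-tuple T.
  by apply: eq_from_tnth => j; rewrite tnth_mktuple.
move=> h'; have {h'} := h' (fun i => etrans (congr1 (mem rho) (e i)) (ht i)).
congr (_ \in rho); apply: eq_from_tnth => j; rewrite !tnth_mktuple.
by congr fop; apply: eq_from_tnth => i; rewrite tnth_mktuple tnth_map.
Qed.

Lemma graph2_inv (R : T -> T -> Prop) : inv2 R ->
  inv (fun x : 'I_2 -> T =>
    [tuple x i | i < 2] \in graph2 (fun a b : T => `[< R a b >])).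
Proof.
move=> hR o t h; rewrite inE !tnth_mktuple; apply/asboolP.
apply: (hR _ (ord0 : 'I_2) ord_max) => i.
by have := h i; rewrite inE !tnth_mktuple => /asboolP.
Qed.

(** A proper non-empty subuniverse is a unary central relation that is its own center. *)
Lemma inv_unary_full (P : T -> Prop) :
  (forall (X : Type) (i : X), inv (fun x : X -> T => P (x i))) ->
  (exists a, P a) -> forall a, P a.
Proof.
move=> hP [a0 Pa0] a; apply: contrapT => nPa.
pose rho := [set t : 1.-tuple T | `[< P (tnth t ord0) >]].
have cE b : (b \in center rho) = `[< P b >].
  rewrite inE; apply/forallP/asboolP => [/(_ [tuple])|Pb u].
    by rewrite inE => /asboolP.
  by rewrite inE; apply/asboolP.
apply: (@inv_not_rosenberg 1 rho) => //.
- by exists [tuple a0]; rewrite inE; apply/asboolP.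
- move=> o t h; rewrite inE tnth_mktuple; apply/asboolP.
  apply: (hP _ (ord0 : 'I_1)) => i.
  by have := h i; rewrite inE tnth_mktuple => /asboolP.
- apply: rosenberg_central; split.
  + by case/tupleP=> x t; rewrite (tuple0 t).
  + move=> s t; rewrite !inE tnth_mktuple.
    by rewrite (_ : s ord0 = ord0) //; apply/val_inj; case: (s ord0) => -[].
  + move=> /setP /(_ a0); rewrite cE inE => /asboolPn; exact.
  + rewrite properE subsetT /=; apply/subsetPn; exists a; first by rewrite inE.
    by rewrite cE; apply/asboolPn.
Qed.

Lemma inv_equivalence (E : T -> T -> Prop) : inv2 E ->
  (forall a, E a a) -> (forall a b, E a b -> E b a) ->
  (forall a b c, E a b -> E b c -> E a c) ->
  (forall a b, E a b -> a = b) \/ forall a b, E a b.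
Proof.
move=> hE rE sE tE; apply: contrapT => /not_orP [h1 h2].
have [x0 _] : exists x : T, True by case: (fcarrier_nonempty A) => x; exists x.
apply: (@inv_not_rosenberg 2 (graph2 (fun a b : T => `[< E a b >]))) => //.
- by exists [tuple x0; x0]; rewrite inE; apply/asboolP.
- exact: graph2_inv.
- apply: rosenberg_equiv; split.
  + by move=> a; apply/asboolP.
  + by move=> a b; apply/asboolP/asboolP; apply: sE.
  + by move=> b a c /asboolP h /asboolP h'; apply/asboolP/(tE _ _ _ h h').
  + move=> /setP e; apply: h1 => a b Eab.
    have := e [tuple a; b]; rewrite !inE /=.
    by rewrite (tnth_nth a) /= (tnth_nth a) /= asboolT // => /esym/eqP.
  + move=> /setP e; apply: h2 => a b.
    have := e [tuple a; b]; rewrite !inE /=.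
    by rewrite (tnth_nth a) /= (tnth_nth a) /= => /asboolP.
Qed.

Lemma inv_no_bounded_order (R : T -> T -> Prop) : inv2 R ->
  (forall a, R a a) -> (forall a b, R a b -> R b a -> a = b) ->
  (forall a b c, R a b -> R b c -> R a c) ->
  (exists c, forall a, R c a) -> (exists c, forall a, R a c) -> False.
Proof.
move=> hR rR aR tR [b hb] [t ht].
apply: (@inv_not_rosenberg 2 (graph2 (fun a b : T => `[< R a b >]))) => //.
- by exists [tuple b; b]; rewrite inE; apply/asboolP.
- exact: graph2_inv.
- apply: rosenberg_order; split.
  + by move=> a; apply/asboolP.
  + by move=> x y /andP [/asboolP h /asboolP h']; apply: aR.
  + by move=> y x z /asboolP h /asboolP h'; apply/asboolP/(tR _ _ _ h h').
  + by exists b => x; apply/asboolP.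
  + by exists t => x; apply/asboolP.
Qed.

Lemma inv_no_prime_perm (s : {perm T}) :
  inv2 (fun a b => s a = b) -> ~ prime_perm s.
Proof.
move=> hs ps.
have [x0 _] : exists x : T, True by case: (fcarrier_nonempty A) => x; exists x.
have e : graph2 (fun a b : T => `[< s a = b >]) = graph2 (fun a b => s a == b).
  by apply/setP => t; rewrite !inE; apply/asboolP/eqP.
apply: (@inv_not_rosenberg 2 (graph2 (fun a b => s a == b))) => //.
- by exists [tuple x0; s x0]; rewrite inE.
- by rewrite -e; apply: graph2_inv.
- exact: rosenberg_perm.
Qed.

Lemma inv_no_affine (add : T -> T -> T) (zero : T) (opp : T -> T) :
  inv4 (fun a b c d => add a b = add c d) -> ~ elementary_abelian add zero opp.
Proof.
move=> h ea; apply: (@inv_not_rosenberg 4 (affine_rel add)) => //.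
- by exists [tuple zero; zero; zero; zero]; rewrite inE !(tnth_nth zero) !inordK.
- move=> o t ht; rewrite inE !tnth_mktuple; apply/eqP.
  apply: (h _ (inord 0 : 'I_4) (inord 1) (inord 2) (inord 3)) => i.
  by have := ht i; rewrite inE !tnth_mktuple => /eqP.
- exact: rosenberg_affine ea.
Qed.

Definition rset (h : nat) (R : ('I_h -> T) -> Prop) : {set h.-tuple T} :=
  [set t | `[< R (tnth t) >]].

Lemma rsetE (h : nat) (R : ('I_h -> T) -> Prop) (x : 'I_h -> T) :
  ([tuple x i | i < h] \in rset R) = `[< R x >].
Proof.
rewrite inE; congr (`[< R _ >]); apply/funext => i; exact: tnth_mktuple.
Qed.

Lemma rset_inv (h : nat) (R : ('I_h -> T) -> Prop) : inv R ->
  inv (fun x : 'I_h -> T => [tuple x i | i < h] \in rset R).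
Proof.
move=> hR o t ht; rewrite rsetE; apply/asboolP; apply: hR => i.
by have := ht i; rewrite rsetE => /asboolP.
Qed.

Lemma uniq_tnth (h : nat) (t : h.-tuple T) : injective (tnth t) -> uniq t.
Proof.
by move=> /injectiveP; rewrite /injectiveb /dinjectiveb map_tnth_enum.
Qed.

Lemma inv_no_central (h : nat) (R : ('I_h -> T) -> Prop) (c : T) :
  0 < h -> inv R -> (forall x, ~ injective x -> R x) ->
  (forall (s : {perm 'I_h}) x, R x -> R (fun i => x (s i))) ->
  (forall x i, x i = c -> R x) -> forall x, R x.
Proof.
case: h R => // h R _ iR tR sR hc x; apply: contrapT => nRx.
apply: (@inv_not_rosenberg h.+1 (rset R)) => //.
- exists [tuple c | i < h.+1]; rewrite rsetE; apply/asboolP.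
  exact: (hc _ ord0).
- exact: rset_inv.
- apply: rosenberg_central; split.
  + move=> t nu; rewrite inE; apply/asboolP; apply: tR => /uniq_tnth.
    exact/negP.
  + by move=> s t; rewrite rsetE inE => /asboolP /sR h'; apply/asboolP/h'.
  + move=> /setP /(_ c); rewrite !inE => /forallP; apply => u.
    by rewrite inE; apply/asboolP; apply: (hc _ ord0).
  + rewrite properE subsetT /=; apply/subsetPn; exists (x ord0); rewrite ?inE //.
    apply/forallP => /(_ [tuple x (lift ord0 i) | i < h]); rewrite inE.
    move/asboolP; rewrite (_ : tnth _ = x) //; apply/funext => i.
    by case: (unliftP ord0 i) => [j|] ->; rewrite ?tnthS ?tnth0 ?tnth_mktuple.
Qed.

Lemma inv_no_regular (h : nat) (J : finType) (R : ('I_h -> T) -> Prop)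
    (phi : T -> J -> 'I_h) :
  inv R -> 3 <= h <= #|T| -> 0 < #|J| ->
  (forall w : J -> 'I_h, exists a, phi a = w) ->
  (forall x, R x <-> forall r, ~ injective (fun i => phi (x i) r)) -> False.
Proof.
move=> iR hh J0 sphi hR.
pose f (a : T) : #|J|.-tuple 'I_h := [tuple phi a (enum_val r) | r < #|J|].
have e : rset R = regularly_generated f.
  apply/setP => t; rewrite !inE; apply/asboolP/forallP => [|h'].
    move=> /hR h' r; apply/negP => u; apply: (h' (enum_val r)).
    move=> i j; rewrite /= => eij; apply/val_inj/eqP.
    rewrite -(@nth_uniq _ (phi (tnth t i) (enum_val r)) _ i j _ _ u) ?size_map ?size_tuple //.
    rewrite !(nth_map (f (tnth t i))) ?size_map ?size_tuple //.
    rewrite !(nth_map (tnth t i)) ?size_tuple //.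
    by rewrite -!(tnth_nth (tnth t i)) !tnth_mktuple eij.
  apply/hR => r inj_r; have /negP := h' (enum_rank r); apply.
  rewrite -map_comp -[X in map _ X]map_tnth_enum -map_comp map_inj_uniq ?enum_uniq //.
  by move=> i j /=; rewrite !tnth_mktuple enum_rankK; apply: inj_r.
apply: (@inv_not_rosenberg h (rset R)) => //.
- by case/andP: hh => h3 _; apply: leq_trans h3.
- case/andP: hh => h3 _; have [x0 _] : exists x : T, True.
    by case: (fcarrier_nonempty A) => x; exists x.
  exists [tuple x0 | _ < h]; rewrite rsetE; apply/asboolP/hR => r inj_r.
  have h1 : 1 < h by apply: leq_trans h3.
  by have /(congr1 val) := inj_r (Ordinal (ltnW h1)) (Ordinal h1) erefl.
- exact: rset_inv.
- rewrite e; apply: rosenberg_regular => // w.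
  have [a ha] := sphi (fun r => tnth w (enum_rank r)); exists a.
  by apply: eq_from_tnth => i; rewrite tnth_mktuple ha enum_valK.
Qed.

End Invariants.

Arguments inv_comp {S A X Y R} f.

(** * Homogeneous relations *)

Definition upd (I : eqType) (B : Type) (x : I -> B) (i : I) (u : B) : I -> B :=
  fun j => if j == i then u else x j.

Lemma upd_id (I : eqType) (B : Type) (x : I -> B) i : upd x i (x i) = x.
Proof. by apply/funext => j; rewrite /upd; case: eqP => [->|]. Qed.

Lemma upd_same (I : eqType) (B : Type) (x : I -> B) i u : upd x i u i = u.
Proof. by rewrite /upd eqxx. Qed.

Lemma upd_other (I : eqType) (B : Type) (x : I -> B) i u j :
  j != i -> upd x i u j = x j.
Proof. by rewrite /upd => /negPf ->. Qed.

Definition totally_refl (h : nat) (B : Type) (R : ('I_h -> B) -> Prop) : Prop :=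
  forall x, ~ injective x -> R x.

Definition symmetric_rel (h : nat) (B : Type) (R : ('I_h -> B) -> Prop) : Prop :=
  forall (s : {perm 'I_h}) x, R x -> R (fun i => x (s i)).

Definition homogeneous (h : nat) (B : Type) (R : ('I_h -> B) -> Prop) : Prop :=
  forall x u, (forall i, R (upd x i u)) -> R x.

Lemma totally_refl_dup (h : nat) (B : Type) (R : ('I_h -> B) -> Prop) x j k :
  totally_refl R -> j != k -> R (upd x j (x k)).
Proof.
move=> tR jk; apply: tR => inj; have := inj j k.
by rewrite upd_same upd_other 1?eq_sym // => /(_ erefl) e; rewrite e eqxx in jk.
Qed.

Lemma not_inj_ord_bool (h : nat) (b : 'I_h -> bool) : 2 < h -> ~ injective b.
Proof.
by move=> h3 /leq_card; rewrite card_ord card_bool leqNgt h3.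
Qed.

Section Arguments.

Variables (h : nat) (h3 : 2 < h) (B Q : Type).
Variables (rho : ('I_h -> B) -> Prop) (rhoQ : ('I_h -> Q) -> Prop).
Hypotheses (rho_refl : totally_refl rho).
Hypotheses (rhoQ_sym : symmetric_rel rhoQ) (rhoQ_hom : homogeneous rhoQ).
Variables (I : finType) (f : (I -> B) -> Q).

Definition tupled (xs : I -> 'I_h -> B) : 'I_h -> Q :=
  fun k => f (fun i => xs i k).

Hypothesis f_hom : forall xs, (forall i, rho (xs i)) -> rhoQ (tupled xs).

Let o0 : 'I_h := Ordinal (ltnW (ltnW h3)).
Let o1 : 'I_h := Ordinal (ltnW h3).
Let o2 : 'I_h := Ordinal h3.

Lemma upd_tupled xs k u :
  upd (tupled xs) k (f u) = tupled (fun i => upd (xs i) k (u i)).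
Proof.
apply/funext => j; rewrite /upd /tupled; case: eqP => _; congr f;
  by apply/funext.
Qed.

Definition hybrid (p q : 'I_h -> Q) (k : nat) : 'I_h -> Q :=
  fun j => if j < k then q j else p j.

(** Passing from p to q one coordinate at a time, homogeneity is used with u = q k: all replacements
    off k lie in [rhoQ], so the one at k, which is the next hybrid, must stay outside. *)
Lemma hybrid_replace (p q : 'I_h -> Q) :
  (forall k i : 'I_h, i != k -> rhoQ (upd (hybrid p q k) i (q k))) ->
  ~ rhoQ p -> ~ rhoQ q.
Proof.
move=> H np; have Hk k : k <= h -> ~ rhoQ (hybrid p q k).
  elim: k => [_|k IH kh].
    by rewrite (_ : hybrid p q 0 = p) //; apply/funext.
  move=> hk; apply: (IH (ltnW kh)); pose k' := Ordinal kh.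
  apply: (@rhoQ_hom _ (q k')) => i; have [->|ik] := eqVneq i k'; last exact: (H k' i ik).
  congr (rhoQ _): hk; apply/funext => j; rewrite /hybrid /upd ltnS leq_eqVlt.
  have -> : (j == k :> nat) = (j == k') by [].
  by case: eqP => [->|].
have := Hk h (leqnn h); congr (~ rhoQ _); apply/funext => j.
by rewrite /hybrid ltn_ord.
Qed.

(* Writing E for the set of arguments outside rho, a suitable u splits E: one *)
(* update of xs keeps a single argument of E outside rho, another one keeps   *)
(* the remaining ones, and all others put every argument inside rho.          *)
Lemma isolate_argument xs : ~ rhoQ (tupled xs) ->
  exists r ys, [/\ ys r = xs r, ~ rho (xs r),
    forall i, i != r -> rho (ys i) & ~ rhoQ (tupled ys)].
Proof.
move En : #|[set i | ~~ `[< rho (xs i) >]]| => n.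
elim/ltn_ind: n xs En => n IH xs En nxs.
have [r0 nr0] : exists r0, ~ rho (xs r0).
  by apply: contrapT => /forallNP hN; apply/nxs/f_hom => i; apply: contrapT.
pose u i := if (i == r0) || `[< rho (xs i) >] then xs i o0 else xs i o1.
have [k nk] : exists k, ~ rhoQ (upd (tupled xs) k (f u)).
  by apply: contrapT => /forallNP hN; apply/nxs/rhoQ_hom => i; apply: contrapT.
rewrite upd_tupled in nk.
have [k0|k0] := eqVneq k o0.
  exists r0, (fun i => upd (xs i) k (u i)); split=> //.
    by rewrite /u eqxx /= k0 upd_id.
  move=> i ir; rewrite /u (negPf ir) /= k0.
  by case: asboolP => [|_]; [rewrite upd_id|apply: totally_refl_dup].
have [k1|k1] := eqVneq k o1; last first.
  case: nk; apply: f_hom => i; rewrite /u; case: ifP => _;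
  exact: totally_refl_dup.
have rE i : ~ rho (upd (xs i) k (u i)) -> i != r0 /\ ~ rho (xs i).
  rewrite /u k1; case: eqVneq => /= [->|ir].
    by case; apply: totally_refl_dup.
  by case: asboolP => [_ []|//]; apply: totally_refl_dup.
have [] := IH #|[set i | ~~ `[< rho (upd (xs i) k (u i)) >]]| _ _ erefl nk.
  rewrite -En; apply: proper_card; apply/properP; split.
    apply/subsetP => i; rewrite !inE => /asboolPn /rE [_ ?]; exact/asboolPn.
  by exists r0; rewrite inE; [exact/asboolPn|apply/negP => /asboolPn/rE []; rewrite eqxx].
move=> r [ys [er nr hr nys]]; have [rr0 nxr] := rE _ nr.
exists r, ys; split=> //; rewrite er /u (negPf rr0) /=.
by case: asboolP => // _; rewrite k1 upd_id.
Qed.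

(** Makes precise that membership in [rhoQ] depends on argument r: constants elsewhere cannot repair
    the effect of d. *)
Definition bad (r : I) (d : 'I_h -> B) : Prop :=
  forall c : I -> B, ~ rhoQ (tupled (upd (fun i _ => c i) r d)).

(** In each hybrid step argument r carries d with a repetition, and any other argument a mixture of
    [ys i] with [c i]. *)
Lemma replace_constant r (d : 'I_h -> B) (ys : I -> 'I_h -> B) (c : I -> B) :
  ys r = d ->
  (forall i (b : pred 'I_h), i != r ->
     rho (fun j => if b j then c i else ys i j)) ->
  ~ rhoQ (tupled ys) -> ~ rhoQ (tupled (upd (fun i _ => c i) r d)).
Proof.
move=> er hys; apply: hybrid_replace => k j jk.
pose v i := upd (fun i _ => c i) r d i k.
pose zs i := upd (fun l : 'I_h => if l < k then upd (fun i _ => c i) r d i l else ys i l)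
                 j (v i).
rewrite (_ : upd _ _ _ = tupled zs); last first.
  apply/funext => l; rewrite /upd /hybrid /tupled /zs /v /upd.
  by case: eqP => _; [congr f|case: ifP => _; congr f]; apply/funext.
apply: f_hom => i; rewrite /zs /v; have [->|ir] := eqVneq i r.
  rewrite (_ : upd _ _ _ = upd d j (d k)); last first.
    apply/funext => l; rewrite /upd; case: eqP => _; rewrite ?eqxx //.
    by case: ifP => // _; rewrite er.
  exact: totally_refl_dup.
have := hys i (fun l : 'I_h => (l == j) || (l < k)) ir; congr (rho _).
apply/funext => l; rewrite /upd (negPf ir).
by case: (l == j) => //=.
Qed.

(** A mixture of two constant tuples takes two values in h > 2 places, so it has a repetition. *)
Lemma bad_of_constant r d (c : I -> B) :
  ~ rhoQ (tupled (upd (fun i _ => c i) r d)) -> bad r d.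
Proof.
move=> nc c'; apply: replace_constant nc; first by rewrite upd_same.
move=> i b ir; apply: rho_refl => inj; apply: (not_inj_ord_bool (b := b) h3).
by move=> j k e; apply: inj; rewrite !upd_other // e.
Qed.

Lemma bad_argument xs : ~ rhoQ (tupled xs) ->
  exists r, ~ rho (xs r) /\ bad r (xs r).
Proof.
move=> /isolate_argument [r [ys [er nr hys nys]]]; exists r; split=> //.
apply: (@bad_of_constant _ _ (fun i => ys i o0)).
apply: replace_constant nys => // i b ir.
(* The constant is coordinate [o0] of [ys i] itself: copied to another place it creates a
   repetition, copied to [o0] alone it changes nothing. *)
have [[j /andP [j0 bj]]|nb] := pselect (exists j, (j != o0) && b j).
  apply: rho_refl => inj; have := inj j o0; rewrite bj if_same => /(_ erefl) e.
  by rewrite e eqxx in j0.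
have := hys i ir; congr (rho _); apply/funext => j; case: ifP => // bj.
have [->//|j0] := eqVneq j o0.
by case: nb; exists j; rewrite j0.
Qed.

Lemma bad_perm r d (y : 'I_h -> 'I_h) : injective y ->
  bad r d <-> bad r (fun k => d (y k)).
Proof.
move=> iy; split=> hb c hc; apply: (hb c).
  have := rhoQ_sym (perm iy)^-1%g hc; congr (rhoQ _); apply/funext => k.
  rewrite /tupled; congr f; apply/funext => i; rewrite /upd; case: eqP => // _.
  by rewrite -(permE iy) permKV.
have := rhoQ_sym (perm iy) hc; congr (rhoQ _); apply/funext => k.
rewrite /tupled; congr f; apply/funext => i; rewrite /upd; case: eqP => // _.
by rewrite permE.
Qed.

Variable d : I -> 'I_h -> B.

Definition boxed (y : I -> 'I_h -> 'I_h) : 'I_h -> Q :=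
  tupled (fun i k => d i (y i k)).

Lemma bad_box y : ~ rhoQ (boxed y) -> exists r, injective (y r) /\ bad r (d r).
Proof.
move=> /bad_argument [r [nr br]]; exists r.
have iy : injective (y r).
  apply: contrapT => niy; apply/nr/rho_refl => inj; apply: niy => j k e.
  by apply: inj; rewrite e.
by split=> //; apply/(bad_perm _ _ iy).
Qed.

(* With f surjective onto U in each of two bad arguments r and s, every tuple *)
(* over U is the value of f at two argument tuples with repetitions: (z,z,w)  *)
(* at r and (u,v,u) at s.                                                     *)
Lemma bad_unique (U : Q -> Prop) (x : 'I_h -> Q) :
  (forall k, U (x k)) -> ~ rhoQ x ->
  (forall r, bad r (d r) -> forall (c : I -> B) v, U v ->
     exists z, f (upd c r z) = v) ->
  forall r s, bad r (d r) -> bad s (d s) -> r = s.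
Proof.
move=> Ux nx surj r s br bs; apply/eqP/negP => /negP rs; apply: nx.
pose c : I -> B := fun i => d r o0.
have /choice [w hw] : forall k, exists w, f (upd c s w) = x k.
  by move=> k; apply: surj.
have [z hz] := surj r br (upd c s (w o0)) (x o2) (Ux o2).
pose xs i := if i == r then (fun k => if k == o2 then z else d r o0)
  else if i == s then (fun k => if k == o2 then w o0 else w k)
  else fun _ => d r o0.
rewrite (_ : x = tupled xs); last first.
  apply/funext => k; rewrite /tupled /xs; have [->|k2] := eqVneq k o2.
    rewrite -hz; congr f; apply/funext => i; rewrite /upd.
    by case: eqP => // _; case: eqP.
  rewrite -hw; congr f; apply/funext => i; rewrite /upd.
  have [->|ir] := eqVneq i r; first by rewrite (negPf rs) (negPf k2).
  by case: eqP; rewrite ?(negPf k2).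
apply: f_hom => i; apply: rho_refl; rewrite /xs.
case: eqP => _; first by move=> /(_ o0 o1 erefl).
case: eqP => _; first by move=> /(_ o0 o2 erefl).
by move=> /(_ o0 o1 erefl).
Qed.

(** A converse of [bad_box] when r is the only bad argument. Starting from constants off r, each
    updated hybrid is a box whose map at r is not injective, so [bad_box] puts it in [rhoQ]. *)
Lemma box_rel_bad r y : bad r (d r) ->
  (forall s, bad s (d s) -> s = r) -> injective (y r) -> ~ rhoQ (boxed y).
Proof.
move=> br ur iy.
have /(bad_perm _ _ iy) /(_ (fun i => d i o0)) := br.
apply: hybrid_replace => k j jk; apply: contrapT.
pose y' i (l : 'I_h) := if l == j then y i k else
  if l < k then y i l else if i == r then y i l else o0.
rewrite (_ : upd _ _ _ = boxed y'); last first.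
  apply/funext => l; rewrite /upd /hybrid /boxed /tupled /y'.
  case: eqP => _; first by congr f.
  case: ifP => _; congr f; apply/funext => i; rewrite /upd.
  by case: eqP => // ->.
move=> /bad_box [s [iy' bs]]; move: iy'; rewrite (ur s bs) /y' eqxx => iy'.
have := iy' j k; rewrite eqxx [k == j]eq_sym (negPf jk) if_same => /(_ erefl) e.
by rewrite e eqxx in jk.
Qed.

End Arguments.

(** * Totally reflexive invariant relations *)

(** The enumeration [e] lets Z be a function space that carries no finite-type structure. *)
Lemma maximal_pred (Y : finType) (Z : Type) (e : Y -> Z)
    (K : (Z -> Prop) -> Prop) : (forall z, exists y, e y = z) ->
  forall P, K P -> exists P', [/\ K P', forall z, P z -> P' z
    & forall P'', K P'' -> (forall z, P' z -> P'' z) -> forall z, P'' z -> P' z].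
Proof.
move=> se P; move En : #|[set y | ~~ `[< P (e y) >]]| => n.
elim/ltn_ind: n P En => n IH P En KP.
have [hP|] := pselect (forall P'', K P'' -> (forall z, P z -> P'' z) ->
  forall z, P'' z -> P z); first by exists P.
move=> /existsNP [P1 /not_implyP [KP1 /not_implyP [PP1]]].
move=> /existsNP [z /not_implyP [P1z nPz]].
have [] := IH #|[set y | ~~ `[< P1 (e y) >]]| _ P1 erefl KP1.
  rewrite -En; apply: proper_card; apply/properP; split.
    apply/subsetP => y; rewrite !inE => /asboolPn h.
    by apply/asboolPn => /PP1.
  have [y ey] := se z; exists y; rewrite !inE ey; first exact/asboolPn.
  by rewrite negbK; apply/asboolP.
by move=> P2 [KP2 h1 h2]; exists P2; split=> // w /PP1 /h1.
Qed.

Lemma ffun_surj (I : finType) (B : Type) (x : I -> B) :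
  exists f : {ffun I -> B}, (fun i => f i) = x.
Proof. by exists [ffun i => x i]; apply/funext => i; rewrite ffunE. Qed.

Lemma noninj_factor (k : nat) (B : eqType) (d : 'I_k.+1 -> B) : ~ injective d ->
  exists (d' : 'I_k -> B) (m : 'I_k.+1 -> 'I_k), d = fun i => d' (m i).
Proof.
move=> /injectiveP /injectivePn [i [j ij eij]].
have [i0 ei|e] := unliftP j i; last by rewrite e eqxx in ij.
exists (fun l => d (lift j l)), (fun l => odflt i0 (unlift j l)).
apply/funext => l; case: unliftP => [l' ->|->] //=.
by rewrite -ei eij.
Qed.

Section TotallyReflexive.

Variables (S : signature) (A : finAlgebra S).
Local Notation T := (fcarrier A).
Hypothesis hrho : rosenberg_free A.

Definition tot_sym (h : nat) (R : ('I_h -> T) -> Prop) : Prop :=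
  [/\ inv R, totally_refl R & symmetric_rel R].

Definition spread (h : nat) : Prop :=
  exists R : ('I_h -> T) -> Prop, tot_sym R /\ exists x, ~ R x.

Lemma full_of_no_spread (h : nat) (R : ('I_h -> T) -> Prop) :
  inv R -> totally_refl R -> ~ spread h -> forall x, R x.
Proof.
move=> iR tR ns x; apply: contrapT => nx; apply: ns.
exists (fun x => forall s : {perm 'I_h}, R (fun i => x (s i))); split; last first.
  exists x => /(_ 1%g); rewrite (_ : (fun _ => _) = x) //.
  by apply/funext => i; rewrite perm1.
split.
- by apply: inv_forall => s; apply: inv_comp.
- move=> y ny s; apply: tR => inj; apply: ny => i j e.
  rewrite -(permKV s i) -(permKV s j); congr (s _); apply: inj.
  by rewrite !permKV.
- move=> s y hy s'; have := hy (s' * s)%g; congr (R _).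
  by apply/funext => i; rewrite permM.
Qed.

(* A Helly-type principle: a tuple with k+1 values that is missing from F,    *)
(* while all tuples with k values belong to F, makes F, read as a relation on *)
(* those k+1 values, totally reflexive but not full.                          *)
Lemma helly (h : nat) (X : Type) (F : (X -> T) -> Prop) :
  (forall k, h < k -> ~ spread k) -> inv F ->
  (forall (d : 'I_h -> T) (y : X -> 'I_h), F (fun a => d (y a))) ->
  forall x, F x.
Proof.
move=> ns iF hF x.
have H k (d : 'I_(k + h) -> T) (y : X -> 'I_(k + h)) : F (fun a => d (y a)).
  elim: k d y => [|k IH] d y; first exact: hF.
  apply: (@full_of_no_spread _ (fun d => F (fun a => d (y a)))).
  - exact: inv_comp.
  - by move=> d' /noninj_factor [d1 [m ->]]; apply: (IH d1 (fun a => m (y a))).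
  - by apply: ns; rewrite addSn ltnS leq_addl.
have c a : enum_rank (x a) < #|T| + h by apply: ltn_addr; apply: ltn_ord.
have [x0 _] : exists x : T, True by case: (fcarrier_nonempty A) => y; exists y.
have := H #|T| (fun i => nth x0 (enum T) i) (fun a => Ordinal (c a)).
congr (F _); apply: funext => a /=.
by rewrite -[RHS]enum_rankK (enum_val_nth x0).
Qed.

Lemma spread_le (h : nat) : spread h -> h <= #|T|.
Proof.
move=> [R [[_ tR _] [x nx]]]; rewrite -[X in X <= _]card_ord; apply: (leq_card x).
by apply: contrapT => /tR.
Qed.

Lemma inv_upd (h : nat) (X : Type) (R : ('I_h -> T) -> Prop)
    (y : 'I_h -> X) (i : 'I_h) : inv R ->
  inv (fun z : option X -> T => R (upd (fun j => z (Some (y j))) i (z None))).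
Proof.
move=> iR; have := inv_comp (fun j => if j == i then None else Some (y j)) iR.
congr inv; apply/funext => z; congr (R _); apply/funext => j.
by rewrite /upd; case: eqP.
Qed.

(** * A maximal totally reflexive relation of the largest arity *)

Section Maximal.

Variables (h : nat) (h3 : 2 < h).
Hypothesis ns : forall k, h < k -> ~ spread k.
Variable rho : ('I_h -> T) -> Prop.
Hypotheses (rho_ts : tot_sym rho) (rho_nf : exists x, ~ rho x).
Hypothesis rho_max : forall R, tot_sym R /\ (exists x, ~ R x) ->
  (forall x, rho x -> R x) -> forall x, R x -> rho x.

Let o0 : 'I_h := Ordinal (ltnW (ltnW h3)).

(** The tuples for which some u works form a relation [sg] above [rho]. If [sg] is not full,
    maximality gives [sg] = [rho], which is homogeneity. If it is full, the Helly principle yields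
    one u working for all tuples at once, and such a u is central. *)
Lemma rho_homogeneous : homogeneous rho.
Proof.
have [iR tR sR] := rho_ts.
pose sg x := exists u, forall i, rho (upd x i u).
have sub x : rho x -> sg x.
  move=> hx; exists (x o0) => i; have [->|i0] := eqVneq i o0.
    by rewrite upd_id.
  exact: totally_refl_dup.
have [nf x u hu|full] := pselect (exists x, ~ sg x).
  apply: (rho_max (R := sg)) => //; last by exists u.
  split=> //; split.
  - apply: inv_ex1; apply: inv_forall => i.
    exact: (inv_upd (y := fun j => j) (i := i) iR).
  - by move=> y ny; apply/sub/tR.
  - move=> s y [v hv]; exists v => i; have := sR s _ (hv (s i)); congr (rho _).
    by apply/funext => j; rewrite /upd (inj_eq perm_inj).
move: full => /forallNP full.
pose F (z : T -> T) := exists u,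
  forall (phi : 'I_h -> T) i, rho (upd (fun j => z (phi j)) i u).
have [||u hu] := @helly h _ F ns _ _ (fun a => a).
- apply: inv_ex1; apply: inv_forall => phi; apply: inv_forall => i.
  exact: (inv_upd (y := phi) (i := i) iR).
- move=> d y; have [u hu] : sg d by apply: contrapT.
  exists u => phi i; pose psi j := y (phi j); apply: contrapT => nr.
  have inj : injective (upd (fun j => d (psi j)) i u).
    by apply: contrapT => ninj; apply/nr/tR.
  have [j0 hj0] : exists j0, forall j, j != i -> psi j != j0.
    apply: contrapT => /forallNP hN.
    have /choice [q hq] : forall j0, exists j, j != i /\ psi j = j0.
      move=> j0; have := hN j0 => /existsNP [j /not_implyP [ji /negP]].
      by rewrite negbK => /eqP; exists j.
    have qi : injective q.
      by move=> a b e; rewrite -(proj2 (hq a)) -(proj2 (hq b)) e.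
    have [q' _ q'K] := injF_bij qi.
    by have [] := hq (q' i); rewrite q'K eqxx.
  have ips : injective (upd psi i j0).
    move=> a b; rewrite /upd; case: eqP => [->|ai]; case: eqP => [->|bi] //.
    + by move=> /esym e; have /eqP := hj0 b (introN eqP bi); rewrite e.
    + by move=> e; have /eqP := hj0 a (introN eqP ai); rewrite e.
    + move=> e; apply: inj; rewrite /upd.
      by case: eqP => // _; case: eqP => // _; rewrite e.
  apply: nr; have := sR (perm ips) _ (hu j0); congr (rho _).
  apply/funext => j; rewrite permE /upd; have [_|ji] := eqVneq j i.
    by rewrite eqxx.
  by rewrite (negPf (hj0 j ji)).
- move=> x _ _; apply: (inv_no_central hrho _ iR tR sR (c := u)) => [|y i e].
    exact: ltnW (ltnW h3).
  by have := hu y i; rewrite -e upd_id.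
Qed.


(** The subuniverse generated by [rho] and the permuted copies of b is totally reflexive, symmetric
    and strictly above [rho]. *)
Lemma generate_full (b : 'I_h -> T) : ~ rho b ->
  forall x, gen (fun y => rho y \/ exists s : {perm 'I_h}, y = fun i => b (s i)) x.
Proof.
have [iR tR sR] := rho_ts; move=> nb; set G := fun y => _.
move=> x; apply: contrapT => nx; apply: nb.
apply: (rho_max (R := gen G)); last 1 first.
- apply: gen_in; right; exists 1%g; apply/funext => i; by rewrite perm1.
- split; last by exists x.
  split; first exact: gen_inv.
    by move=> y ny; apply: gen_in; left; apply: tR.
  move=> s y; elim=> [{}y [hy|[s' ->]]|o t _ IH].
  + by apply: gen_in; left; apply: sR.
  + apply: gen_in; right; exists (s * s')%g; apply/funext => i.
    by rewrite permM.
  + exact: (gen_op (t := fun i j => t i (s j))).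
- by move=> y hy; apply: gen_in; left.
Qed.

(** The identity, a point of the power of A indexed by A, is generated by the maps with at most h
    values, by the Helly principle. *)
Lemma box_decomposition : exists (I : finType) (t : (I -> T) -> T)
    (d : I -> 'I_h -> T) (y : I -> T -> 'I_h),
  pol t /\ forall a, t (fun i => d i (y i a)) = a.
Proof.
pose G (z : T -> T) := exists (d : 'I_h -> T) (y : T -> 'I_h),
  z = fun a => d (y a).
have : gen G (fun a => a).
  apply: (helly ns); first exact: gen_inv.
  by move=> d y; apply: gen_in; exists d, y.
move=> /gen_pol [I [t [g [pt /choice [d /choice [y hg]] e]]]].
exists I, t, d, y; split=> // a; rewrite [RHS](congr1 (@^~ a) e).
by congr t; apply/funext => i; rewrite hg.
Qed.

Definition nontrivial_map (p : T -> T) : Prop :=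
  (forall x, rho x -> rho (fun k => p (x k))) /\
  exists x, ~ rho (fun k => p (x k)).

Lemma const_rho (c : T) : rho (fun _ => c).
Proof.
have [_ tR _] := rho_ts.
by apply: tR => /(_ o0 (Ordinal h3) erefl).
Qed.

Lemma map_argument (I : finType) (f : (I -> T) -> T) (r : I) (d : 'I_h -> T) :
  (forall xs, (forall i, rho (xs i)) -> rho (tupled f xs)) ->
  bad rho f r d -> forall c, nontrivial_map (fun z => f (upd c r z)).
Proof.
move=> hf br c.
have e x : (fun k => f (upd c r (x k))) = tupled f (upd (fun i _ => c i) r x).
  apply/funext => k; rewrite /tupled; congr f; apply/funext => i.
  by rewrite /upd; case: eqP.
split=> [x hx|]; last by exists d; rewrite e; apply: br.
rewrite e; apply: hf => i; rewrite /upd; case: eqP => // _.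
exact: const_rho.
Qed.

(** Take [p0] of least image and generate a tuple that it sends outside [rho] from [rho] and copies
    of x, by some s. A bad argument of [p0] after s must carry a copy of x; freezing the others
    gives a map that separates x and whose image lies in that of [p0]. *)
Lemma minimal_separating_map (x : 'I_h -> T) : ~ rho x ->
  exists p, [/\ nontrivial_map p, ~ rho (fun k => p (x k))
    & forall q, nontrivial_map q -> #|[set p a | a in T]| <= #|[set q a | a in T]|].
Proof.
have [iR tR sR] := rho_ts; move=> nx.
pose img (p : T -> T) := #|[set p a | a in T]|.
have ex : exists n, `[< exists p, nontrivial_map p /\ img p = n >].
  exists (img (fun a => a)); apply/asboolP; exists (fun a => a); split=> [|//].
  by split; [|exists x].
have [n /asboolP [p0 [[p0rho [x0 nx0]] en]] minn] := ex_minnP ex.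
have {}minn q : nontrivial_map q -> n <= img q.
  by move=> hq; apply: minn; apply/asboolP; exists q.
have [I [s [g [ps hg e]]]] := gen_pol (generate_full nx x0).
pose f (z : I -> T) := p0 (s z).
have hf xs : (forall i, rho (xs i)) -> rho (tupled f xs).
  by move=> hxs; apply: p0rho; apply: ps.
have [|r [nr br]] := bad_argument h3 tR rho_homogeneous hf (xs := g).
  by congr (~ rho _): nx0; rewrite e.
case: (hg r) => // -[s' es].
have Mp := map_argument hf br (fun _ => x o0).
exists (fun z => f (upd (fun _ => x o0) r z)); split=> //.
  move=> h'; apply: (br (fun _ => x o0)); have := sR s' _ h'; congr (rho _).
  apply/funext => k; rewrite /tupled es; congr f; apply/funext => i.
  by rewrite /upd; case: eqP.
move=> q /minn; apply: leq_trans; rewrite -en; apply: subset_leq_card.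
by apply/subsetP => _ /imsetP [z _ ->]; apply: imset_f.
Qed.

(** Minimality of the image makes every bad argument of p after t run through the whole image of p,
    so [bad_unique] leaves a single one; its [y r] is the colouring. *)
Lemma colouring (x : 'I_h -> T) : ~ rho x ->
  exists kappa : T -> 'I_h, injective (fun k => kappa (x k)) /\
    forall z, rho z -> ~ injective (fun k => kappa (z k)).
Proof.
have [iR tR sR] := rho_ts; move=> nx.
have [p [Mp npx minp]] := minimal_separating_map nx.
have [I [t [d [y [pt ht]]]]] := box_decomposition.
pose f (z : I -> T) := p (t z).
have hf xs : (forall i, rho (xs i)) -> rho (tupled f xs).
  by move=> hxs; apply: (proj1 Mp); apply: pt.
have boxE z : (fun k => p (z k)) = boxed f d (fun i k => y i (z k)).
  by apply/funext => k; rewrite /boxed /tupled /f ht.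
have [|r [ir br]] := bad_box h3 tR sR rho_homogeneous hf (d := d)
                       (y := fun i k => y i (x k)).
  by rewrite -boxE.
exists (y r); split=> // z hz inj.
have uniq s : bad rho f s (d s) -> s = r.
  move=> bs; apply: (bad_unique h3 tR hf (U := fun v => exists a, v = p a)
    (x := fun k => p (x k))) bs br => // [k|]; first by exists (x k).
  move=> r' br' c v [a ->].
  have Mq := map_argument hf br' c.
  have : p a \in [set f (upd c r' z) | z in T].
    rewrite (_ : [set _ | z in T] = [set p a | a in T]) ?imset_f //.
    apply/eqP; rewrite eqEcard minp // andbT.
    by apply/subsetP => _ /imsetP [w _ ->]; apply: imset_f.
  by move=> /imsetP [w _ ->]; exists w.
apply: (box_rel_bad h3 tR sR rho_homogeneous hf
  (y := fun i k => y i (z k)) br uniq inj).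
by rewrite -boxE; apply: (proj1 Mp).
Qed.

Lemma maximal_rel_false : False.
Proof.
have [iR tR sR] := rho_ts.
have [I [t [d [y [pt ht]]]]] := box_decomposition.
have thom xs : (forall i, rho (xs i)) -> rho (tupled t xs) by apply: pt.
have boxE z : z = boxed t d (fun i k => y i (z k)).
  by apply/funext => k; rewrite /boxed /tupled ht.
(* Each bad argument of t decides alone: after a colouring of one value outside [rho], the target
   relation is non-injectivity on h colours, and r becomes the only bad argument. *)
have C r Y : bad rho t r (d r) -> injective (Y r) -> ~ rho (boxed t d Y).
  move=> br iY.
  have [kap [ik kr]] := colouring (br (fun _ => d r o0)).
  pose f (z : I -> T) := kap (t z); pose rq (x : 'I_h -> 'I_h) := ~ injective x.
  have hf xs : (forall i, rho (xs i)) -> rq (tupled f xs).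
    by move=> hxs; apply: kr; apply: thom.
  have rqs : symmetric_rel rq.
    move=> s x nx inj; apply: nx => i j e.
    rewrite -(permKV s i) -(permKV s j); congr (s _); apply: inj.
    by rewrite !permKV.
  have rqh : homogeneous rq.
    move=> x u hx inj; have [x' _ x'K] := injF_bij inj.
    by apply: (hx (x' u)); rewrite -{2}(x'K u) upd_id.
  have br2 : bad rq f r (d r).
    by apply: (bad_of_constant h3 tR rqh hf (c := fun _ => d r o0)).
  have uniq s : bad rq f s (d s) -> s = r.
    move=> bs; apply: (bad_unique h3 tR hf (U := fun _ => True)
      (x := fun k => k)) bs br2 => //; first by apply.
    move=> r' br' c v _; have := br' c; rewrite /rq => /contrapT inj.
    have [k' _ k'K] := injF_bij inj; exists (d r' (k' v)).
    rewrite -[RHS](k'K v) /tupled; congr f; apply/funext => i.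
    by rewrite /upd; case: eqP.
  move=> hr; apply: (box_rel_bad h3 tR rqs rqh hf br2 uniq iY).
  exact: kr.
pose J := {r : I | `[< bad rho t r (d r) >]}.
have relE x : rho x <-> forall r : J, ~ injective (fun i => y (val r) (x i)).
  split=> [hx r inj|hx].
    apply: (C _ (fun i k => y i (x k)) (asboolW (valP r)) inj).
    by rewrite -boxE.
  apply: contrapT; rewrite {1}(boxE x) => nx.
  have [r [ir br]] := bad_box h3 tR sR rho_homogeneous thom nx.
  exact: (hx (exist _ r (asboolT br))).
have [x nx] := rho_nf.
apply: (inv_no_regular hrho (R := rho) (phi := fun a (r : J) => y (val r) a)) => //.
- by rewrite h3; apply: spread_le; exists rho.
- apply: contrapT => /negP; rewrite -eqn0Ngt => /eqP J0; apply: nx.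
  by apply/relE => r; have := card0_eq J0 r; rewrite inE.
move=> w; pose wt i := if insub i is Some r then w r else o0.
have wtE (r : J) : wt (val r) = w r by rewrite /wt valK.
exists (t (fun i => d i (wt i))); set a := t _; apply/funext => r.
apply: contrapT => ne.
(* [Y] and [Y'] give the same tuple, since column [o0] is a in both. The first is outside [rho],
   having a permutation at r; but if [y r a] differs from [w r], no argument of the second has an
   injective map. *)
pose Y i k := if i == val r then tperm o0 (w r) k else wt i.
pose Y' i k := if k == o0 then y i a else Y i k.
have hY : ~ rho (boxed t d Y).
  apply: (C _ _ (asboolW (valP r))); rewrite /Y eqxx; exact: perm_inj.
have : ~ rho (boxed t d Y').
  congr (~ rho _): hY; apply/funext => k; rewrite /boxed /tupled /Y'.
  case: eqP => [->|//]; rewrite ht /a; congr t; apply/funext => i.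
  by rewrite /Y; case: eqP => [->|//]; rewrite tpermL wtE.
move=> /(bad_box h3 tR sR rho_homogeneous thom) [s [inj _]].
move: inj; rewrite /Y' /Y; case: eqP => [->|_] inj.
  pose k := tperm o0 (w r) (y (val r) a).
  have k0 : k != o0.
    apply/eqP => e; apply: ne.
    by rewrite -[LHS](tpermK o0 (w r)) -/k e tpermL.
  have := inj k o0; rewrite eqxx (negPf k0) {1}/k tpermK => /(_ erefl) e.
  by rewrite e eqxx in k0.
by have := inj (Ordinal (ltnW h3)) (Ordinal h3) erefl.
Qed.

End Maximal.

Theorem no_spread (h : nat) : 2 < h -> ~ spread h.
Proof.
move=> h3 sh.
have ex : exists n, `[< spread n >] by exists h; apply/asboolP.
have bd n : `[< spread n >] -> n <= #|T| by move=> /asboolP /spread_le.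
have [n /asboolP [R hR] maxn] := ex_maxnP ex bd.
have n3 : 2 < n by apply: leq_trans h3 _; apply: maxn; apply/asboolP.
have ns k : n < k -> ~ spread k.
  move=> nk sk; have /asboolP /maxn := sk; by rewrite leqNgt nk.
have [rho [[ts nf] _ rmax]] := maximal_pred
  (K := fun R => tot_sym R /\ exists x, ~ R x)
  (e := fun f : {ffun 'I_n -> T} => fun i => f i) (@ffun_surj _ _) hR.
exact: (maximal_rel_false n3 ns ts nf rmax).
Qed.

End TotallyReflexive.

(** * Binary invariant relations *)

Section Binary.

Variables (S : signature) (A : finAlgebra S).
Local Notation T := (fcarrier A).
Hypotheses (hrho : rosenberg_free A) (hA : 1 < #|T|).

Lemma other_element (a : T) : exists b, b <> a.
Proof.
apply: contrapT => /forallNP h; move: hA; rewrite ltnNge => /negP; apply.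
rewrite -(card1 a); apply: subset_leq_card; apply/subsetP => b _.
by rewrite inE; apply/eqP; apply: contrapT; apply: h.
Qed.

Lemma helly2 (X : Type) (F : (X -> T) -> Prop) : inv F ->
  (forall (a b : T) (y : X -> bool), F (fun x => if y x then a else b)) ->
  forall x, F x.
Proof.
move=> iF hF; apply: (helly (no_spread hrho)) => // d y.
have := hF (d ord0) (d ord_max) (fun x => y x == ord0); congr (F _).
apply/funext => x; case: eqP => [->//|]; case: (y x) => -[|[|//]] hy ne.
  by case: ne; apply: val_inj.
by congr d; apply: val_inj.
Qed.

Lemma totally_refl3 (R : T -> T -> T -> Prop) : inv3 R ->
  (forall a b, R a a b) -> (forall a b, R a b a) -> (forall a b, R a b b) ->
  forall a b c, R a b c.
Proof.
move=> iR h1 h2 h3 a b c; pose x := tnth [tuple a; b; c].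
pose i0 : 'I_3 := inord 0; pose i1 : 'I_3 := inord 1; pose i2 : 'I_3 := inord 2.
have : R (x i0) (x i1) (x i2).
  move: x; apply: helly2; first exact: iR.
  by move=> u v y; case: (y i0); case: (y i1); case: (y i2).
by rewrite /x !(tnth_nth a) !inordK.
Qed.

Lemma inv_diag (R : T -> T -> Prop) a : inv2 R -> R a a -> forall x, R x x.
Proof.
move=> iR Raa; apply: (inv_unary_full hrho (P := fun x => R x x)).
  by move=> X i; apply: iR.
by exists a.
Qed.

Lemma common1 (R : T -> T -> Prop) : inv2 R ->
  (forall a b, exists u, R u a /\ R u b) -> exists u, forall a, R u a.
Proof.
move=> iR h; pose F (z : T -> T) := exists u, forall a, R u (z a).
have : F (fun a => a); last by [].
apply: helly2.
  by apply: inv_ex1; apply: inv_forall => a; apply: iR.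
by move=> a b y; have [u [h1 h2]] := h a b; exists u => c; case: ifP.
Qed.

Lemma common2 (R : T -> T -> T -> Prop) : inv3 R ->
  (forall a b, exists u v, R u v a /\ R u v b) ->
  exists u v, forall a, R u v a.
Proof.
move=> iR h; pose F (z : T -> T) := exists u v, forall a, R u v (z a).
have : F (fun a => a); last by [].
apply: helly2.
  by apply: inv_ex1; apply: inv_ex1; apply: inv_forall => a; apply: iR.
by move=> a b y; have [u [v [h1 h2]]] := h a b; exists u, v => c; case: ifP.
Qed.

Lemma common3 (R : T -> T -> T -> T -> Prop) : inv4 R ->
  (forall a b, exists u v w, R u v w a /\ R u v w b) ->
  exists u v w, forall a, R u v w a.
Proof.
move=> iR h; pose F (z : T -> T) := exists u v w, forall a, R u v w (z a).
have : F (fun a => a); last by [].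
apply: helly2.
  by do 3!apply: inv_ex1; apply: inv_forall => a; apply: iR.
by move=> a b y; have [u [v [w [h1 h2]]]] := h a b; exists u, v, w => c; case: ifP.
Qed.

Lemma inv2_comp (R Q : T -> T -> Prop) : inv2 R -> inv2 Q ->
  inv2 (fun a b => exists u, R a u /\ Q u b).
Proof.
by move=> iR iQ X i j; apply: inv_ex1; apply: inv_and; [apply: iR | apply: iQ].
Qed.

Lemma inv2_flip (R : T -> T -> Prop) : inv2 R -> inv2 (fun a b => R b a).
Proof. by move=> iR X i j; apply: iR. Qed.

Lemma binary_central (R : T -> T -> Prop) c : inv2 R ->
  (forall a, R a a) -> (forall a b, R a b -> R b a) ->
  (forall a, R c a) -> forall a b, R a b.
Proof.
move=> iR rR sR hc a b.
pose P (x : 'I_2 -> T) := R (x ord0) (x ord_max).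
have o2 (i : 'I_2) : i = ord0 \/ i = ord_max.
  by case: i => -[|[|//]] hi; [left|right]; apply: val_inj.
have : P (fun i => if i == ord0 then a else b); last by rewrite /P eqxx.
apply: (inv_no_central hrho (c := c)) => //.
- exact: iR.
- move=> x nx; apply: contrapT => h; apply: nx => i j e.
  by case: (o2 i) (o2 j) e => -> [] -> // e; case: h; rewrite /P e.
- move=> s x; rewrite /P.
  case: (o2 (s ord0)) (o2 (s ord_max)) => e [] e'; rewrite e e' //.
  exact: sR.
- by move=> x i; rewrite /P; case: (o2 i) => -> ->; [|apply: sR]; apply: hc.
Qed.

(** Let P be maximal and not full. Its square is full, and then [common1] gives a central element,
    or it is P, and then P is an equivalence. *)
Lemma tolerance (R : T -> T -> Prop) : inv2 R ->
  (forall a, R a a) -> (forall a b, R a b -> R b a) ->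
  (forall a b, R a b -> a = b) \/ forall a b, R a b.
Proof.
move=> iR rR sR; apply: contrapT => /not_orP [h1 h2].
pose K (P : T * T -> Prop) := [/\ inv2 (fun a b => P (a, b)),
  forall a, P (a, a), forall a b, P (a, b) -> P (b, a) & exists a b, ~ P (a, b)].
have KR : K (fun p => R p.1 p.2).
  split=> //; apply: contrapT => h; apply: h2 => a b; apply: contrapT => nab.
  by apply: h; exists a, b.
have [|P [[iP rP sP [a [b nab]]] RP maxP]] :=
  maximal_pred (e := fun p : T * T => p) _ KR; first by move=> z; exists z.
have iC := inv2_comp iP iP.
have sub p : P p -> exists u, P (p.1, u) /\ P (u, p.2).
  by case: p => x y h; exists x.
have [full|nf] := pselect (forall x y, exists u, P (x, u) /\ P (u, y)).
  have [x y|c hc] := common1 iP.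
    by have [u [h h']] := full x y; exists u; split=> //; apply: sP.
  by apply: nab; apply: (binary_central iP rP sP hc).
have tP x y z : P (x, y) -> P (y, z) -> P (x, z).
  move=> h h'; apply: (maxP (fun p => exists u, P (p.1, u) /\ P (u, p.2))) => //.
    split=> //.
    - by move=> x'; exists x'.
    - by move=> x' y' [u [k k']]; exists u; split; apply: sP.
    - apply: contrapT => hn; apply: nf => x' y'; apply: contrapT => hn'.
      by apply: hn; exists x', y'.
  by exists y.
case: (inv_equivalence hrho iP rP sP tP) => [h|h]; last by apply: nab; apply: h.
by apply: h1 => x y Rxy; apply: h; apply: (RP (x, y)).
Qed.

(** A maximal counterexample P is a bounded order: its symmetric part is a tolerance, hence
    equality, and its square is not full, hence equal to P. *)
Lemma order_full (R : T -> T -> Prop) : inv2 R ->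
  (exists c, forall a, R c a) -> (exists c, forall a, R a c) ->
  forall a b, R a b.
Proof.
move=> iR botR topR a b; apply: contrapT => nab.
pose K (P : T * T -> Prop) := [/\ inv2 (fun a b => P (a, b)),
  exists c, forall a, P (c, a), exists c, forall a, P (a, c)
  & exists a b, ~ P (a, b)].
have KR : K (fun p => R p.1 p.2) by split=> //; exists a, b.
have [|P [[iP [c hc] [d hd] nf]] _ maxP] :=
  maximal_pred (e := fun p : T * T => p) _ KR; first by move=> z; exists z.
have rP : forall x, P (x, x) by apply: (inv_diag (a := c) iP).
have aP x y : P (x, y) -> P (y, x) -> x = y.
  move=> h h'.
  have [||x' y' []//|ae|full] := @tolerance (fun x y => P (x, y) /\ P (y, x)).
  - move=> X i j; apply: inv_and; first exact: iP.
    exact: (inv2_flip iP).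
  - by [].
  - exact: ae.
  - by have [x' [y' []]] := nf; case: (full x' y').
have [e ne] := other_element d.
have tP x y z : P (x, y) -> P (y, z) -> P (x, z).
  move=> h h'; apply: (maxP (fun p => exists u, P (p.1, u) /\ P (u, p.2))).
  - split.
    + exact: (inv2_comp iP iP).
    + by exists c => x'; exists c.
    + by exists d => x'; exists d.
    (* By antisymmetry the top d is related only to itself, so the square misses [(d, e)]. *)
    + exists d, e => -[u /= [h1 h2]]; apply: ne; apply: (aP _ _ (hd e)).
      by rewrite {1}(aP _ _ h1 (hd u)).
  - by case=> x' y' k; exists x'.
  - by exists y.
apply: (inv_no_bounded_order hrho iP rP aP tP); first by exists c.
by exists d.
Qed.

(** Otherwise some power of s has prime order p. Its fixed points form a proper subuniverse, hence
    there are none, and all its cycles have length p. *)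
Lemma inv_perm_trivial (s : {perm T}) : inv2 (fun a b => s a = b) -> s = 1%g.
Proof.
move=> hs; apply: contrapT => /eqP s1.
have hX k : inv2 (fun a b => (s ^+ k)%g a = b).
  elim: k => [|k IH].
    move=> X i j; have := @inv_eq S A X i j; congr inv; apply/funext => x.
    by rewrite expg0 perm1.
  have := inv2_comp hs IH; congr inv2; apply/funext => a; apply/funext => b.
  rewrite expgS permM; apply/propext; split=> [[u [-> //]]|h].
  by exists (s a).
have o1 : 1 < #[s]%g by rewrite order_gt1.
pose p := pdiv #[s]%g; have pp : prime p by apply: pdiv_prime.
pose s' := (s ^+ (#[s] %/ p))%g.
have os' : #[s']%g = p.
  rewrite orderXdiv ?divn_dvd // ?dvdn_div ?pdiv_dvd //.
  by rewrite divnA ?pdiv_dvd // mulKn ?order_gt0.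
have nfix x : s' x <> x.
  move=> fx; have : s' = 1%g.
    apply/permP => y; rewrite perm1; move: y.
    exact: (inv_diag (R := fun a b => s' a = b) (hX _) fx).
  by move=> e; move: pp; rewrite -os' e order1.
apply: (inv_no_prime_perm hrho (s := s') (hX _)).
exists p; split=> // x.
have : #|porbit s' x| %| p by rewrite porbitE -os'; apply: dvdn_orbit.
move=> /(primeP pp).2 /orP [/cards1P [y ey]|/eqP //].
have : s' x \in porbit s' x by have := mem_porbit s' 1 x; rewrite expg1.
have : x \in porbit s' x by apply: porbit_id.
by rewrite ey !inE => /eqP {1}<- /eqP /nfix.
Qed.

(** Both composites of R with its converse are tolerances. If both are equality, R is a permutation;
    if both are full, [common1] leads to [order_full]; the mixed cases identify a with b. *)
Theorem binary_full (R : T -> T -> Prop) a b : inv2 R ->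
  R a b -> a <> b -> forall x y, R x y.
Proof.
move=> iR Rab nab.
have d1 : forall x, exists y, R x y.
  apply: (inv_unary_full hrho); last by exists a, b.
  by move=> X i; apply: inv_ex1; apply: iR.
have d2 : forall y, exists x, R x y.
  apply: (inv_unary_full hrho); last by exists b, a.
  by move=> X i; apply: inv_ex1; apply: iR.
have t1 := tolerance (inv2_comp iR (inv2_flip iR)).
have t2 := tolerance (inv2_comp (inv2_flip iR) iR).
case: t1 => [x|x y [u [h h']]|eq1|full1]; try by exists u.
- by have [u] := d1 x; exists u.
- case: t2 => [x|x y [u [h h']]|eq2|full2]; try by exists u.
  + by have [u] := d2 x; exists u.
  + have /choice [f hf] := d1.
    have fi : injective f.
      by move=> x y e; apply: eq1; exists (f x); split; rewrite // e.
    have RE x y : R x y <-> perm fi x = y.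
      rewrite permE; split=> [h|<-]; last exact: hf.
      by apply: eq2; exists x.
    have /inv_perm_trivial s1 : inv2 (fun a b => perm fi a = b).
      congr inv2: iR; apply/funext => x; apply/funext => y; exact/propext.
    by case: nab; move/RE: Rab; rewrite s1 perm1.
  + have [u0 h0] := d1 a; have [u1 h1] := d1 b.
    have [w [k0 k1]] := full2 u0 u1; case: nab.
    by transitivity w; [|apply/esym]; apply: eq1; [exists u0|exists u1].
- case: t2 => [x|x y [u [h h']]|eq2|full2]; try by exists u.
  + by have [u] := d2 x; exists u.
  + have [u0 h0] := d2 a; have [u1 h1] := d2 b.
    have [w [k0 k1]] := full1 u0 u1; case: nab.
    by transitivity w; [|apply/esym]; apply: eq2; [exists u0|exists u1].
  + apply: order_full => //; first exact: common1.
    apply: (common1 (inv2_flip iR)) => x y.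
    by have [u [h h']] := full1 x y; exists u.
Qed.

End Binary.

(** * Affine relations *)

Section Affine.

Variables (S : signature) (A : finAlgebra S).
Local Notation T := (fcarrier A).
Hypotheses (hrho : rosenberg_free A) (hA : 1 < #|T|).

(* F x y z t stands for y - x = t - z. *)
Definition parallelogram (F : T -> T -> T -> T -> Prop) : Prop :=
  [/\ inv4 F, forall x z, F x x z z, forall x y, F x y x y,
      forall x z t, F x x z t -> z = t & forall x y z, F x y z z -> x = y].

(** Otherwise [common3] gives a, b, c with F a b c d for every d; d = c forces a = b, and then every
    d equals c. *)
Lemma parallelogram_functional F : parallelogram F ->
  forall x y z t t', F x y z t -> F x y z t' -> t = t'.
Proof.
move=> [iF _ _ F3 F4] x y z t t' h h'; apply: contrapT => ne.
have full : forall a b, exists u v w, F u v w a /\ F u v w b.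
  apply: (binary_full hrho hA (a := t) (b := t')) => //; last by exists x, y, z.
  by move=> X i j; do 3!apply: inv_ex1; apply: inv_and; apply: iF.
have [a [b [c habc]]] := common3 hrho iF full.
have [d dc] := other_element hA c.
apply: dc; apply/esym; apply: (F3 a); have := habc d.
by rewrite -(F4 _ _ _ (habc c)).
Qed.

Lemma no_parallelogram F : parallelogram F ->
  ~ (forall x y z, exists t, F x y z t).
Proof.
move=> pF tot; have [iF F1 F2 F3 F4] := pF; have fF := parallelogram_functional pF.
(* F composed with its converse, as relations between pairs, is again a functional parallelogram
   relation. It is therefore contained in F, which makes F symmetric and transitive on pairs. *)
pose F' x y z t := exists p q, F x y p q /\ F z t p q.
have iF' : inv4 F'.
  by move=> X i j k l; do 2!apply: inv_ex1; apply: inv_and; apply: iF.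
have pF' : parallelogram F'.
  split=> //.
  - by move=> x z; exists x, x; split; apply: F1.
  - by move=> x y; exists x, y; split; apply: F2.
  - by move=> x z t [p [q [/F3 -> /F4]]].
  - by move=> x y z [p [q [h /F3 e]]]; apply: (F4 _ _ p); rewrite -e in h.
have fF' := parallelogram_functional pF'.
have F'F x y z t : F' x y z t -> F x y z t.
  move=> h; have [t' h'] := tot x y z; rewrite (fF' _ _ _ _ _ h (_ : F' x y z t')) //.
  by exists z, t'; split.
have Fsym x y z t : F x y z t -> F z t x y.
  by move=> h; apply: F'F; exists z, t; split; [apply: F2|].
have Ftrans x y z t p q : F x y z t -> F z t p q -> F x y p q.
  by move=> h /Fsym h'; apply: F'F; exists z, t; split.
(* Commutativity in disguise: it holds for triples with a repetition, hence for all. *)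
have Fswap x y z t : F x y z t -> F x z y t.
  have full := @totally_refl3 _ _ hrho
    (fun x y z => exists t, F x y z t /\ F x z y t).
  move=> h; have [||||t' [h1 h2]] := full _ _ _ _ x y z.
  - by move=> X i j k; apply: inv_ex1; apply: inv_and; apply: iF.
  - by move=> a b; exists b.
  - by move=> a b; exists b.
  - by move=> a b; have [u] := tot a b b; exists u.
  - by rewrite (fF _ _ _ _ _ h h1).
have [zero _] : exists x : T, True.
  by case: (fcarrier_nonempty A) => x; exists x.
have /choice [add' hadd'] : forall p : T * T, exists t, F zero p.1 p.2 t.
  by move=> p; apply: tot.
pose add x y := add' (x, y).
have hadd x y : F zero x y (add x y) by exact: (hadd' (x, y)).
have addE x y t : F zero x y t -> add x y = t.
  by move=> h; apply: fF h; apply: hadd.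
have addC : commutative add.
  by move=> x y; apply: addE; apply: Fswap; apply: hadd.
have add0 : left_id zero add by move=> x; apply: addE; apply: F1.
have addA : associative add.
  move=> x y z; apply/esym; rewrite addC; apply: addE; rewrite [in X in F _ _ X]addC.
  have h1 : F y (add x y) (add y z) (add x (add y z)).
    by apply: Ftrans (hadd x (add y z)); apply/Fsym; apply: hadd.
  rewrite addC; apply: Ftrans (Fswap _ _ _ _ h1).
  by rewrite [add y z]addC; apply: hadd.
have /choice [opp hopp] : forall x, exists t, F x zero zero t.
  by move=> x; apply: tot.
have addN : left_inverse zero opp add.
  by move=> x; apply: addE; apply: Fsym.
have cancel x y z : add x y = add x z -> y = z.
  move=> e; rewrite -[y]add0 -(addN x) -addA e addA addN add0 //.
have FE x y z t : F x y z t <-> add x t = add y z.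
  have dir u v w s : F u v w s -> add u s = add v w.
    move=> h; pose m := add w (opp u).
    have hm : F zero m u w.
      have := hadd m u; rewrite /m -addA addN.
      by rewrite [add w zero]addC add0.
    have -> : s = add m v.
      apply/esym; apply: addE; apply: Ftrans hm _; exact: Fswap.
    rewrite /m [add w _]addC -addA addA [add u _]addC addN add0.
    exact: addC.
  split=> [|e]; first exact: dir.
  have [t' h] := tot x y z; have := dir _ _ _ _ h.
  by rewrite -e => /cancel <-.
pose mul n x := iter n (add x) zero.
have mulD m n x : mul (m + n) x = add (mul m x) (mul n x).
  elim: m => [|m IH]; first by rewrite add0.
  by rewrite addSn /mul !iterS -!/(mul _ _) IH addA.
have mulM m n x : mul n (mul m x) = mul (n * m) x.
  elim: n => [//|n IH]; rewrite mulSn mulD -IH.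
  by rewrite [in LHS]/mul iterS.
(* The future prime n is the least positive integer killing a non-zero element; the order of the
   translation by x shows that one exists. *)
have ex : exists n, `[< 0 < n /\ exists x, x <> zero /\ mul n x = zero >].
  have [x nx] := other_element hA zero.
  have inj : injective (add x) by move=> y z; apply: cancel.
  exists #[perm inj]%g; apply/asboolP; split; first exact: order_gt0.
  exists x; split=> //; rewrite /mul.
  have := permX (perm inj) zero #[perm inj]%g; rewrite expg_order perm1 => e.
  by rewrite [RHS]e; apply: eq_iter => y; rewrite permE.
have [n /asboolP [n0 [x0 [nx0 e0]]] minn] := ex_minnP ex.
have {}minn k x : 0 < k -> x <> zero -> mul k x = zero -> n <= k.
  by move=> k0 nx e; apply: minn; apply/asboolP; split=> //; exists x.
have mul0 k : mul k zero = zero.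
  by elim: k => [//|k IH]; rewrite /mul iterS -/(mul _ _) IH add0.
(* st k a b z w says w = z + k (a - b) *)
pose st := fix st (k : nat) a b z w : Prop :=
  if k is k'.+1 then exists u, st k' a b z u /\ F b a u w else z = w.
have ist k : inv4 (st k).
  elim: k => [|k IH] X i j l m; first exact: inv_eq.
  by apply: inv_ex1; apply: inv_and; [apply: IH|apply: iF].
have stE k a z w : st k a zero z w <-> w = add (mul k a) z.
  elim: k w => [|k IH] w; first by rewrite add0; split.
  split=> [[u [/IH -> // /FE]]|->].
    by rewrite add0 addA.
  exists (add (mul k a) z); split; first exact/IH.
  by apply/FE; rewrite add0 addA.
(* The condition n (a - b) = 0 is invariant in a and b and holds for [x0] and [zero], hence for all
   pairs. *)
have all0 x : mul n x = zero.
  have [||z /stE e] := binary_full hrho hA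
    (R := fun a b => exists z, st n a b z z) (a := x0) (b := zero) _ _ nx0 x zero.
  - by move=> X i j; apply: inv_ex1; apply: ist.
  - by exists zero; apply/stE; rewrite e0 add0.
  - apply: (cancel z); rewrite [add z zero]addC add0 addC; exact: esym.
have n1 : 1 < n.
  rewrite ltn_neqAle n0 andbT; apply/eqP => e; apply: nx0.
  by have := all0 x0; rewrite -e /mul /= addC add0.
apply: (inv_no_affine hrho (add := add) (zero := zero) (opp := opp)).
  move=> X i j k l; have := iF X i k l j; congr inv; apply/funext => x.
  exact/propext.
split; first by split.
exists n; split; last first.
  move=> x nx; split; [by []|exact: all0|] => k /andP [k0 kn] e.
  by have := minn k x k0 nx e; rewrite leqNgt kn.
(* If n = k m is a proper factorisation, the non-zero element m [x0] is killed by k < n. *)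
apply: contrapT => /negP np.
have [m m1 /dvdnP [k ek]] : exists2 m, 1 < m < n & m %| n.
  by case/primePn: np => //; rewrite ltnNge n1.
case/andP: m1 => m1 mn.
have m0 : 0 < m by apply: ltnW.
have k0 : 0 < k by move: n0; rewrite ek muln_gt0 => /andP [].
have kn : k < n by rewrite ek -[X in X < _]muln1 ltn_pmul2l.
have nz : mul m x0 <> zero.
  by move=> e; have := minn m x0 m0 nx0 e; rewrite leqNgt mn.
have := minn k (mul m x0) k0 nz; rewrite mulM -ek => /(_ e0).
by rewrite leqNgt kn.
Qed.

End Affine.

(** * Relations of higher arity *)

Section Higher.

Variables (S : signature) (A : finAlgebra S).
Local Notation T := (fcarrier A).
Hypotheses (hrho : rosenberg_free A) (hA : 1 < #|T|).

Let full2 := @binary_full _ _ hrho hA.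

(** Otherwise [common2] gives c1, c2 with G c1 c2 t for every t; t = c1 forces c2 = c1, and then
    every t equals c1. *)
Lemma even_ternary (G : T -> T -> T -> Prop) : inv3 G ->
  (forall x z, G x z z) -> (forall x t, G x x t -> t = x) ->
  (forall x z, G x z x -> z = x) -> forall x z t, G x z t -> z = t.
Proof.
move=> iG G1 G2 G3 x z t h; apply: contrapT => ne.
have [|c1 [c2 hc]] := common2 hrho iG.
  apply: (full2 (a := z) (b := t)) => //; last by exists x, z.
  by move=> X i j; do 2!apply: inv_ex1; apply: inv_and; apply: iG.
have e := G3 _ _ (hc c1); have [d nd] := other_element hA c1.
by apply: nd; apply: G2; have := hc d; rewrite e.
Qed.

(* On two-element subsets R says that z is x or y, K that t is x, y or z, and *)
(* F that each value is taken an even number of times.                        *)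
Lemma no_between (R : T -> T -> T -> Prop) : inv3 R ->
  (forall x y, R x y x) -> (forall x y, R x y y) ->
  ~ (forall x z, R x x z -> z = x).
Proof.
move=> iR R1 R2 R3.
pose K t x y z := exists w, R x y w /\ R w z t.
have iK : inv4 K.
  by move=> X i j k l; apply: inv_ex1; apply: inv_and; apply: iR.
have K1 x y z : K x x y z by exists x.
have K2 x y z : K y x y z by exists y.
have K3 x y z : K z x y z by exists x.
have K0 t x : K t x x x -> t = x by move=> [w [/R3 -> /R3]].
pose F x y z t := K x y z t /\ K y x z t /\ K z x y t /\ K t x y z.
have iF : inv4 F.
  move=> X i j k l; apply: inv_and; first exact: iK.
  by apply: inv_and; [|apply: inv_and]; apply: iK.
have F1 x z : F x x z z by [].
have F2 x y : F x y x y by [].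
apply: (no_parallelogram hrho hA (F := F)).
  split=> //.
  - apply: (even_ternary (G := fun x z t => F x x z t)) => //.
    + by move=> x t [_ [_ [_ /K0]]].
    + by move=> x z [_ [_ [/K0]]].
  - move=> x y z; move: z x y.
    apply: (even_ternary (G := fun z x y => F x y z z)) => //.
    + by move=> x t [_ [/K0]].
    + by move=> x z [/K0].
apply: (totally_refl3 hrho).
- by move=> X i j k; apply: inv_ex1; apply: iF.
- by move=> x z; exists z.
- by move=> x y; exists y.
- by move=> x y; exists x.
Qed.

Lemma two_pairs_full (R : T -> T -> T -> Prop) : inv3 R ->
  (forall x y, R x y x) -> (forall x y, R x y y) -> forall x y z, R x y z.
Proof.
move=> iR R1 R2; have [R3|] := pselect (forall x z, R x x z -> z = x).
  by case: (no_between iR R1 R2).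
move=> /existsNP [a /existsNP [b /not_implyP [Rab nab]]].
apply: (totally_refl3 hrho) => //.
by apply: (full2 (a := a) (b := b)) => // e; apply: nab.
Qed.

(** Some c1, c2 are related to every third coordinate. If they differ, R contains the two families
    of [two_pairs_full]. If not, R contains all (x, x, z), and the same argument on the first
    coordinate supplies a second family. *)
Lemma undetermined_full (R : T -> T -> T -> Prop) a b c u v w w' : inv3 R ->
  R a b c -> a <> b -> R u v w -> R u v w' -> w <> w' -> forall x y z, R x y z.
Proof.
move=> iR Rabc nab Ruvw Ruvw' nw.
have iR13 : inv2 (fun x y => R x y x) by move=> X i j; apply: iR.
have iR23 : inv2 (fun x y => R x y y) by move=> X i j; apply: iR.
have [|c1 [c2 hc]] := common2 hrho iR.
  apply: (full2 (a := w) (b := w')) => //; last by exists u, v.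
  by move=> X i j; do 2!apply: inv_ex1; apply: inv_and; apply: iR.
have [e|ne] := pselect (c1 = c2); last first.
  apply: two_pairs_full => //.
    exact: (full2 iR13 (hc c1) ne).
  exact: (full2 iR23 (hc c2) ne).
rewrite -{c2}e in hc; have [d nd] := other_element hA c1.
have R12 x z : R x x z.
  by apply: (full2 (R := fun x z => R x x z) (a := c1) (b := d)) => // e; apply: nd.
have iR' : inv3 (fun x y z => R z x y) by move=> X i j k; apply: iR.
have iR'' : inv3 (fun x y z => R x z y) by move=> X i j k; apply: iR.
have [|d2 [d3 hd]] := common2 hrho iR'.
  apply: (full2 (a := a) (b := b)) => //; last by exists b, c.
  by move=> X i j; do 2!apply: inv_ex1; apply: inv_and; apply: iR.
have [e|ne] := pselect (d2 = d3).
  move=> x y z; apply: (two_pairs_full iR'') => // x' y'.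
  have [f nf] := other_element hA d2.
  by apply: (full2 iR23 (_ : R f d2 d2) nf); rewrite {2}e.
move=> x y z; apply: (two_pairs_full iR') => // x' y'.
by apply: (full2 iR13 (hd d3)) => e; apply: ne.
Qed.

(** If R is not full it is the graph of a quasigroup. Reading R x u w as x + u = w, the relation [Q]
    says y - x = u - v = t - z. *)
Theorem ternary_full (R : T -> T -> T -> Prop) : inv3 R ->
  (exists x y z, R x y z /\ x <> y) -> (exists x y z, R x y z /\ x <> z) ->
  (exists x y z, R x y z /\ y <> z) -> forall x y z, R x y z.
Proof.
move=> iR [a1 [b1 [c1 [R1 n1]]]] [a2 [b2 [c2 [R2 n2]]]] [a3 [b3 [c3 [R3 n3]]]].
move=> x0 y0 z0; apply: contrapT => nR.
have d3 x y z z' : R x y z -> R x y z' -> z = z'.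
  move=> h h'; apply: contrapT => ne; apply: nR.
  exact: (undetermined_full iR R1 n1 h h' ne).
have d1 x x' y z : R x y z -> R x' y z -> x = x'.
  move=> h h'; apply: contrapT => ne; apply: nR.
  apply: (undetermined_full (R := fun a b c => R c b a) _ R3 _ h h' ne).
    by move=> X i j k; apply: iR.
  by move=> e; apply: n3.
have d2 x y y' z : R x y z -> R x y' z -> y = y'.
  move=> h h'; apply: contrapT => ne; apply: nR.
  apply: (undetermined_full (R := fun a b c => R a c b) _ R2 n2 h h' ne).
  by move=> X i j k; apply: iR.
have t3 : forall x y, exists z, R x y z.
  apply: (full2 (a := a1) (b := b1)) => //; last by exists c1.
  by move=> X i j; apply: inv_ex1; apply: iR.
have t2 : forall x z, exists y, R x y z.
  apply: (full2 (a := a2) (b := c2)) => //; last by exists b2.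
  by move=> X i j; apply: inv_ex1; apply: iR.
have t1 : forall y z, exists x, R x y z.
  apply: (full2 (a := b3) (b := c3)) => //; last by exists a3.
  by move=> X i j; apply: inv_ex1; apply: iR.
pose Q x y z t := exists u v w s,
  R x u w /\ R y v w /\ R z u s /\ R t v s.
apply: (no_parallelogram hrho hA (F := Q)).
  split.
  - move=> X i j k l; do 4!apply: inv_ex1.
    by do 3!(apply: inv_and; first exact: iR); apply: iR.
  - move=> x z; have [w hw] := t3 x x; have [s hs] := t3 z x.
    by exists x, x, w, s.
  - move=> x y; have [u hu] := t2 x x; have [v hv] := t2 y x.
    by exists u, v, x, x.
  - move=> x z t [u [v [w [s [h1 [h2 [h3 h4]]]]]]].
    by move: h4; rewrite -(d2 _ _ _ _ h1 h2); apply: d1.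
  - move=> x y z [u [v [w [s [h1 [h2 [h3 h4]]]]]]].
    by move: h2; rewrite -(d2 _ _ _ _ h3 h4); apply: d1.
move=> x y z; have [w h1] := t3 x x; have [v h2] := t2 y w.
have [s h3] := t3 z x; have [t h4] := t1 v s.
by exists t, x, v, w, s.
Qed.

Definition free_rel (X : Type) (R : (X -> T) -> Prop) : Prop :=
  forall i j, i <> j -> exists x, R x /\ x i <> x j.

(** * From arity m to arity m + 1 *)

Section Step.

Variables (m : nat) (m3 : 2 < m).
Hypothesis IH : forall R : ('I_m -> T) -> Prop,
  inv R -> (exists x, R x) -> free_rel R -> forall x, R x.
Variable R : ('I_m.+1 -> T) -> Prop.
Hypotheses (iR : inv R) (neR : exists x, R x) (fR : free_rel R).

Lemma project_out (j : 'I_m.+1) (z : 'I_m.+1 -> T) :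
  exists x, R x /\ forall k, k != j -> x k = z k.
Proof.
have := @IH (fun y => exists2 x, R x & y = fun k => x (lift j k)).
case/(_ _ _ _ (fun k => z (lift j k))).
- exact: inv_image.
- by case: neR => x Rx; exists (fun k => x (lift j k)), x.
- move=> k l kl; have [|x [Rx ne]] := fR (i := lift j k) (j := lift j l).
    by move=> /lift_inj.
  by exists (fun k => x (lift j k)); split=> //; exists x.
move=> x Rx e; exists x; split=> // k; rewrite eq_sym => /unlift_some [k' -> _].
exact: esym (congr1 (@^~ k') e).
Qed.

Lemma avoid_index (s : seq 'I_m.+1) : size s <= m -> exists j, j \notin s.
Proof.
move=> hs; apply: contrapT => /forallNP h.
have : #|'I_m.+1| <= size s.
  apply: leq_trans (card_size s); apply: subset_leq_card.
  by apply/subsetP => j _; apply: contrapT => /negP; apply: h.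
by rewrite card_ord leqNgt ltnS hs.
Qed.

(** Identifying i with j leaves a relation of arity m, which is full if free. Otherwise it forces x
    k = x l; by [project_out] a coordinate beyond i, j, k, l would allow a violation, so there are
    exactly four. *)
Lemma diagonal_dichotomy (i j : 'I_m.+1) : i != j ->
  (forall x, x i = x j -> R x) \/
  exists k l, [/\ m = 3, uniq [:: i; j; k; l],
    forall x, R x -> x i = x j -> x k = x l
    & forall x, x i = x j -> x k = x l -> R x].
Proof.
move=> ij; have [a [b nab]] : exists a b : T, a <> b.
  by case: neR => x _; have [b] := other_element hA (x i); exists b, (x i).
have [i0 ei|e] := unliftP j i; last by rewrite e eqxx in ij.
pose mu k := odflt i0 (unlift j k).
have muj : mu j = i0 by rewrite /mu unlift_none.
have mul k : mu (lift j k) = k by rewrite /mu liftK.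
pose R' (z : 'I_m -> T) := R (fun k => z (mu k)).
have toR' x : R x -> x i = x j -> R' (fun k => x (lift j k)).
  move=> Rx e; congr R: Rx; apply/funext => k.
  by case: (unliftP j k) => [k' ->|->]; rewrite ?mul // muj -ei.
have ofR' x : R' (fun k => x (lift j k)) -> x i = x j -> R x.
  move=> R'x e; congr R: R'x; apply/funext => k.
  by case: (unliftP j k) => [k' ->|->]; rewrite ?mul // muj -ei.
have neR' : exists x, R' x.
  have [j0] := avoid_index (s := [:: i; j]) (ltnW m3).
  rewrite !inE negb_or ![j0 == _]eq_sym => /andP [ni nj].
  have [x [Rx hx]] := project_out j0 (fun _ => a).
  by exists (fun k => x (lift j k)); apply: toR'; rewrite ?hx.
have iR' : inv R' by apply: inv_comp.
have [fR'|] := pselect (free_rel R').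
  by left=> x; apply: ofR'; apply: IH.
move=> /existsNP [k0 /existsNP [l0 /not_implyP [kl0 nkl]]].
pose k := lift j k0; pose l := lift j l0; right; exists k, l.
have kl : k != l by apply/eqP => /lift_inj.
have forced x : R x -> x i = x j -> x k = x l.
  move=> Rx e; apply: contrapT => ne; apply: nkl.
  by exists (fun k => x (lift j k)); split=> //; apply: toR'.
have covered j0 : j0 \in [:: i; j; k; l].
  apply: contrapT => /negP; rewrite !inE !negb_or ![j0 == _]eq_sym.
  move=> /and4P [ni nj nk nl].
  (* One of k and l may be i; c is one that is not, so marking it separates x k from x l and keeps x
     i = x j. *)
  pose c := if k == i then l else k.
  have [x [Rx hx]] := project_out j0 (fun n => if n == c then a else b).
  have jk : j != k by rewrite /k neq_lift.
  have jl : j != l by rewrite /l neq_lift.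
  have ci : (i == c) = false.
    rewrite /c; case: (eqVneq k i) => [<-|]; first exact: negPf.
    by rewrite eq_sym => /negPf.
  have cj : (j == c) = false by rewrite /c; case: ifP => _; apply: negPf.
  have := forced x Rx; rewrite !hx // ci cj => /(_ erefl).
  rewrite /c; case: (eqVneq k i) => _; rewrite eqxx.
    by rewrite (negPf kl) => /esym.
  by rewrite eq_sym (negPf kl).
have m_eq : m = 3.
  apply/eqP; rewrite eqn_leq m3 andbT -ltnS -[X in X < _]card_ord.
  have : #|'I_m.+1| <= size [:: i; j; k; l].
    apply: leq_trans (card_size _); apply: subset_leq_card.
    by apply/subsetP => j0 _; apply: covered.
  by rewrite !card_ord.
have u : uniq [:: i; j; k; l].
  apply/card_uniqP; transitivity #|'I_m.+1|; last by rewrite card_ord /= m_eq.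
  by apply: eq_card => j0; rewrite covered.
split=> // x eij ekl.
pose P p q := R (fun n => if (n == k) || (n == l) then q else p).
have iP : inv2 P.
  move=> X p q; have := inv_comp (fun n => if (n == k) || (n == l) then q else p) iR.
  congr inv; apply/funext => y; congr R; apply/funext => n.
  by case: ifP.
have ik : i != k by move: u; rewrite /= !inE !negb_or => /and4P [/and3P []].
have il : i != l by move: u; rewrite /= !inE !negb_or => /and4P [/and3P []].
have jk : j != k by move: u; rewrite /= !inE !negb_or => /and4P [_ /andP []].
have jl : j != l by move: u; rewrite /= !inE !negb_or => /and4P [_ /andP []].
have ext (y : 'I_m.+1 -> T) : y i = y j -> y k = y l ->
    (fun n => if (n == k) || (n == l) then y k else y i) = y.
  move=> e e'; apply/funext => n; have := covered n; rewrite !inE.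
  move=> /or4P [] /eqP ->.
  - by rewrite (negPf ik) (negPf il).
  - by rewrite (negPf jk) (negPf jl).
  - by rewrite eqxx.
  - by rewrite eqxx orbT.
have [y [Ry hy]] := project_out l (fun n => if n == k then a else b).
have yij : y i = y j by rewrite !hy // (negPf ik) (negPf jk).
have : P (x i) (x k); last by rewrite /P ext.
apply: (full2 (a := b) (b := a) iP) => [|e]; last exact: nab.
have := Ry; rewrite -(ext y yij (forced y Ry yij)) /P.
by rewrite !hy ?eqxx ?(negPf ik).
Qed.

(** If R contains every diagonal, it is totally reflexive and [no_spread] applies. Otherwise there
    are four coordinates, and intersecting R over their permutations gives a total parallelogram
    relation. *)
Lemma arity_step : forall x, R x.
Proof.
have [all2|] := pselect (forall i j, i != j -> forall x, x i = x j -> R x).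
  apply: full_of_no_spread => //.
    by move=> x /injectiveP /injectivePn [i [j ij e]]; apply: all2 e.
  by apply: no_spread => //; apply: ltnW.
move=> /existsNP [i /existsNP [j /not_implyP [ij nij]]].
have [//|[k [l [m_eq u forced _]]]] := diagonal_dichotomy ij.
have pairs (p q r s : 'I_m.+1) (x : 'I_m.+1 -> T) :
    uniq [:: p; q; r; s] -> x p = x q -> x r = x s -> R x.
  move=> u' e e'; have pq : p != q.
    by move: u'; rewrite /= !inE !negb_or => /and4P [/and3P []].
  have [h|[k' [l' [_ u'' _ h]]]] := diagonal_dichotomy pq; first exact: h.
  apply: h => //.
  have cov n : n \in [:: p; q; r; s].
    have /subset_cardP h : #|[:: p; q; r; s]| = #|'I_m.+1|.
      by rewrite (card_uniqP u') card_ord /= m_eq.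
    by rewrite (h (subset_predT _)).
  have rs n : n \in [:: r; s] -> x n = x r.
    by rewrite !inE => /orP [] /eqP ->.
  have notpq n : n != p -> n != q -> n \in [:: r; s].
    by move=> np nq; have := cov n; rewrite !inE (negPf np) (negPf nq).
  move: u''; rewrite /= !inE !negb_or.
  move=> /and4P [/and3P [_ pk pl] /andP [qk ql] _ _].
  by rewrite !rs ?notpq // eq_sym.
pose F a b c d := forall s : {perm 'I_4}, forall c4 : m.+1 = 4,
  R (fun n => tnth [tuple a; b; c; d] (s (cast_ord c4 n))).
have c4 : m.+1 = 4 by rewrite m_eq.
pose o (n : nat) : 'I_4 := inord n.
have oE a b c d : (tnth [tuple a; b; c; d] (o 0) = a :> T) *
    (tnth [tuple a; b; c; d] (o 1) = b) *
    (tnth [tuple a; b; c; d] (o 2) = c) * (tnth [tuple a; b; c; d] (o 3) = d).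
  by rewrite /o !(tnth_nth a) !inordK.
have Fpairs a b c d p q r s : uniq [:: p; q; r; s] ->
    tnth [tuple a; b; c; d] (o p) = tnth [tuple a; b; c; d] (o q) ->
    tnth [tuple a; b; c; d] (o r) = tnth [tuple a; b; c; d] (o s) ->
    all (fun n => n < 4) [:: p; q; r; s] -> F a b c d.
  move=> u' e e' lt s' c4'.
  pose g n := cast_ord (esym c4') ((s'^-1)%g (o n)).
  apply: (pairs (g p) (g q) (g r) (g s)).
  - rewrite -[[:: _; _; _; _]]/(map g [:: p; q; r; s]) map_inj_in_uniq //.
    move=> n n' hn hn' /cast_ord_inj /perm_inj /(congr1 val).
    by rewrite /o /= !inordK //; apply: (allP lt).
  - by rewrite /g !cast_ordKV !permKV.
  - by rewrite /g !cast_ordKV !permKV.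
have iF : inv4 F.
  move=> X a b c d; apply: inv_forall => s; apply: inv_forall => c4'.
  have := inv_comp (fun n => tnth [tuple a; b; c; d] (s (cast_ord c4' n))) iR.
  congr inv; apply/funext => x; congr R; apply/funext => n.
  rewrite -(tnth_map x); congr (tnth _ _); exact: val_inj.
have place (p q r s : 'I_m.+1) a b c d : uniq [:: p; q; r; s] -> F a b c d ->
    exists x, [/\ R x, x p = a, x q = b & x r = c /\ x s = d].
  move=> u' Fabcd.
  pose f (n : 'I_4) := cast_ord c4 (nth p [:: p; q; r; s] n).
  have fi : injective f.
    move=> n n' /cast_ord_inj /eqP; rewrite nth_uniq // => /eqP.
    exact: val_inj.
  have fo n (n4 : n < 4) : (perm fi)^-1%g (cast_ord c4 (nth p [:: p; q; r; s] n)) = o n.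
    by apply: (@perm_inj _ (perm fi)); rewrite permKV permE /f /o inordK.
  exists (fun n => tnth [tuple a; b; c; d] ((perm fi)^-1%g (cast_ord c4 n))).
  by split; rewrite ?(fo 0) ?(fo 1) ?(fo 2) ?(fo 3) ?oE //; apply: Fabcd.
have u2 : uniq [:: k; l; i; j].
  by rewrite -(rot_uniq 2).
case: (no_parallelogram hrho hA (F := F)).
  split=> //.
  - by move=> x z; apply: (Fpairs _ _ _ _ 0 1 2 3) => //; rewrite !oE.
  - by move=> x y; apply: (Fpairs _ _ _ _ 0 2 1 3) => //; rewrite !oE.
  - move=> a c d /(place _ _ _ _ _ _ _ _ u) [x [Rx xi xj [<- <-]]].
    by apply: forced => //; rewrite xi.
  - move=> a b c /(place _ _ _ _ _ _ _ _ u2) [x [Rx <- <- [xi xj]]].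
    by apply: forced => //; rewrite xi.
apply: (totally_refl3 hrho).
- by move=> X a b c; apply: inv_ex1; apply: iF.
- by move=> x z; exists z; apply: (Fpairs _ _ _ _ 0 1 2 3) => //; rewrite !oE.
- by move=> x y; exists y; apply: (Fpairs _ _ _ _ 0 2 1 3) => //; rewrite !oE.
- by move=> x y; exists x; apply: (Fpairs _ _ _ _ 0 3 1 2) => //; rewrite !oE.
Qed.

End Step.

Lemma free_full (n : nat) (R : ('I_n -> T) -> Prop) :
  inv R -> (exists x, R x) -> free_rel R -> forall x, R x.
Proof.
elim: n R => [|m IH] R iR [x0 Rx0] fR x.
  by rewrite (_ : x = x0) //; apply/funext => -[].
case: m => [|[|[|m]]] in R iR x0 Rx0 fR x IH *; last first.
- by apply: arity_step IH _ iR _ fR _ => //; exists x0.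
- pose P a b c := R (tnth [tuple a; b; c]).
  have tE (y : 'I_3 -> T) : y = tnth [tuple y (inord 0); y (inord 1); y (inord 2)].
    apply/funext => k; rewrite (tnth_nth (y k)).
    by case: k => -[|[|[|//]]] hk; congr y; apply: val_inj; rewrite /= inordK.
  have iP : inv3 P.
    move=> X a b c; have := inv_comp (tnth [tuple a; b; c]) iR.
    congr inv; apply/funext => y; congr R; apply/funext => k.
    rewrite -(tnth_map y); congr (tnth _ _); exact: val_inj.
  have nP p q : p < q < 3 -> exists y, R y /\ y (inord p) <> y (inord q).
    move=> /andP [pq q3]; apply: fR => /(congr1 val).
    by rewrite /= !inordK // => [e|]; [rewrite e ltnn in pq|apply: ltn_trans q3].
  rewrite (tE x); apply: (ternary_full iP).
  + have [//|y] := nP 0 1; rewrite {1}(tE y) => -[h h'].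
    by exists (y (inord 0)), (y (inord 1)), (y (inord 2)).
  + have [//|y] := nP 0 2; rewrite {1}(tE y) => -[h h'].
    by exists (y (inord 0)), (y (inord 1)), (y (inord 2)).
  + have [//|y] := nP 1 2; rewrite {1}(tE y) => -[h h'].
    by exists (y (inord 0)), (y (inord 1)), (y (inord 2)).
- pose P a b := R (fun k => if k == ord0 then a else b).
  have tE (y : 'I_2 -> T) : y = fun k => if k == ord0 then y ord0 else y ord_max.
    apply/funext => k; case: eqP => [->//|]; case: k => -[|[|//]] hk ne.
      by case: ne; apply: val_inj.
    by congr y; apply: val_inj.
  have iP : inv2 P.
    move=> X a b; have := inv_comp (fun k => if k == ord0 then a else b) iR.
    congr inv; apply/funext => y; congr R; apply/funext => k.
    by case: ifP.
  have [//|y [Ry ny]] := fR ord0 ord_max.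
  rewrite (tE x); apply: (full2 iP _ ny).
  by rewrite /P -tE.
- rewrite (_ : x = fun _ => x ord0); last first.
    by apply/funext => k; rewrite ord1.
  apply: (inv_unary_full hrho (P := fun a => R (fun _ => a))).
    by move=> X i; apply: (inv_comp (fun _ => i) iR).
  exists (x0 ord0); congr R: Rx0; apply/funext => k; by rewrite ord1.
Qed.

Lemma forced_representatives (X : finType) (R : (X -> T) -> Prop) :
  exists rep : X -> X, (forall i y, R y -> y (rep i) = y i) /\
    forall i j, (forall y, R y -> y i = y j) -> rep i = rep j.
Proof.
pose eqv i j := `[< forall y, R y -> y i = y j >].
exists (fun i => odflt i [pick j | eqv i j]); split=> [i y Ry|i j h].
  by case: pickP => [j /asboolP -> |].
have <- : [pick j' | eqv i j'] = [pick j' | eqv j j'].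
  apply: eq_pick => k; rewrite /eqv; congr asbool; apply/propext.
  by split=> h' y Ry; rewrite -?(h' y Ry) ?(h y Ry) // -(h y Ry).
by case: pickP => // /(_ i); rewrite /eqv asboolT.
Qed.

(** Keeping one coordinate from each class of always equal ones leaves a free relation, so
    [free_full] applies. *)
Theorem inv_diagonal (X : finType) (R : (X -> T) -> Prop) (x : X -> T) :
  inv R -> (exists y, R y) ->
  (forall i j, (forall y, R y -> y i = y j) -> x i = x j) -> R x.
Proof.
move=> iR [y0 Ry0] hx; have [rep [repP rep_eq]] := forced_representatives R.
pose Y : finType := {i : X | rep i == i}.
have repY i : rep (rep i) == rep i.
  by apply/eqP/rep_eq => y Ry; apply: repP.
pose q i : Y := exist _ (rep i) (repY i).
pose R' (z : 'I_#|Y| -> T) := R (fun i => z (enum_rank (q i))).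
have toR' y : R y -> R' (fun k => y (val (enum_val k))).
  by move=> Ry; congr R: (Ry); apply/funext => i; rewrite enum_rankK repP.
have : R' (fun k => x (val (enum_val k))).
  apply: free_full.
  - exact: inv_comp.
  - by exists (fun k => y0 (val (enum_val k))); apply: toR'.
  - move=> k l kl; apply: contrapT => hN; apply: kl; apply: enum_val_inj.
    apply: val_inj; rewrite -(eqP (valP (enum_val k))) -(eqP (valP (enum_val l))).
    apply: rep_eq => y Ry; apply: contrapT => ne; apply: hN.
    by exists (fun k => y (val (enum_val k))); split=> //; apply: toR'.
congr R; apply/funext => i; rewrite enum_rankK; apply: hx => y; exact: repP.
Qed.

End Higher.

(** * Terms and identities *)

Section Terms.

Variable S : signature.

Inductive term (V : Type) : Type :=
| Var of V
| App (o : symbol S) of ('I_(arity o) -> term V).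

Fixpoint eval (V : Type) (B : algebra S) (e : V -> B) (p : term V) : B :=
  match p with
  | Var v => e v
  | App o ts => op [tuple eval e (ts i) | i < arity o]
  end.

Lemma eval_hom (V : Type) (B C : algebra S) (f : B -> C) (e : V -> B)
    (p : term V) : hom f -> f (eval e p) = eval (fun v => f (e v)) p.
Proof.
move=> hf; elim: p => //= o ts IH; rewrite hf; congr op.
by apply: eq_from_tnth => i; rewrite tnth_map !tnth_mktuple IH.
Qed.

Definition satisfies_identities (A B : algebra S) : Prop :=
  forall n (p q : term 'I_n),
    (forall e : 'I_n -> A, eval e p = eval e q) ->
    forall e : 'I_n -> B, eval e p = eval e q.

(** The easy half of Birkhoff's theorem. *)
Lemma satisfies_identities_variety (A : algebra S) :
  is_variety (satisfies_identities A).
Proof.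
split=> [B C f hf sf KB n p q pq e|B C f hf jf KC n p q pq e|I B KB n p q pq e].
- have /choice [e' he'] : forall i, exists b, f b = e i by move=> i; apply: sf.
  rewrite (_ : e = fun i => f (e' i)); last by apply/funext.
  by rewrite -!eval_hom // (KB n p q pq).
- by apply: jf; rewrite !eval_hom //; apply: KC.
- apply: functional_extensionality_dep => i.
  have hp : @hom S (prod_algebra B) (B i) (fun x => x i) by [].
  rewrite (eval_hom e p hp) (eval_hom e q hp); exact: KB.
Qed.

End Terms.

(** * Finite members of the generated variety *)

Section Spectrum.

Variables (S : signature) (A : finAlgebra S).
Local Notation T := (fcarrier A).
Hypotheses (hrho : rosenberg_free A) (hA : 1 < #|T|).

Lemma spectrum_power (m : nat) : spectrum A m -> exists n, m = #|T| ^ n.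
Proof.
move=> [B [gB [f [g fK gK]]]].
have KB : satisfies_identities A B.
  by apply: (gB _ (satisfies_identities_variety A)) => n p q; apply.
(* The coordinates [X] are the evaluations of m variables. The term operations [fn p] form the free
   algebra [F], and [K] is the kernel of its map onto B. *)
pose X := {ffun 'I_m -> T}.
pose fn (p : term S 'I_m) (e : X) : T := @eval S _ A e p.
have fnE p q : fn p = fn q -> eval g p = eval g q.
  move=> e; apply: KB => u.
  have eu : u = finfun u :> ('I_m -> T) by apply/funext => i; rewrite ffunE.
  by rewrite eu; exact: (congr1 (@^~ (finfun u)) e).
have [v0 _] : exists v : 'I_m, True.
  by case: (carrier_nonempty B) => x; exists (f x).
pose F (x : X -> T) := exists p, x = fn p.
pose join (x y : X -> T) (c : X + X) :=
  match c with inl a => x a | inr a => y a end.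
pose K (z : X + X -> T) := exists p q,
  z = join (fn p) (fn q) /\ eval g p = eval g q.
have iF : inv F.
  move=> o t /choice [p hp]; exists (App p); apply/funext => e.
  rewrite /fn /= /opf; congr fop; apply: eq_from_tnth => i.
  by rewrite !tnth_mktuple hp.
have iK : inv K.
  move=> o t /choice [p /choice [q hpq]]; exists (App p), (App q); split.
    by apply/funext => -[e|e]; rewrite /= /fn /= /opf; congr fop;
      apply: eq_from_tnth => i; rewrite !tnth_mktuple; case: (hpq i) => ->.
  by rewrite /=; congr op; apply: eq_from_tnth => i; rewrite !tnth_mktuple;
    case: (hpq i).
have [rep [repP rep_eq]] := forced_representatives F.
have repF p a : fn p (rep a) = fn p a by apply: repP; exists p.
(* [G] collects the coordinates at which congruent elements must agree; [Y] keeps one of them from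
   each class of coordinates equal throughout [F]. *)
pose G (a : X) := forall z, K z -> z (inl a) = z (inr a).
pose Y : finType := {a : X | (rep a == a) && `[< G a >]}.
have repY a : G a -> (rep (rep a) == rep a) && `[< G (rep a) >].
  move=> Ga; apply/andP; split.
    by apply/eqP/rep_eq => _ [p ->].
  apply/asboolP => _ [p [q [-> e]]] /=; rewrite !repF.
  by apply: (Ga (join (fn p) (fn q))); exists p, q.
pose psi (b : B) : {ffun Y -> T} := [ffun a : Y => (val a : X) (f b)].
have psiE b (a : Y) : psi b a = fn (Var _ (f b)) (val a) by rewrite ffunE.
have varE b : eval g (Var S (f b)) = b by rewrite /= fK.
have psi_inj : injective psi.
  move=> b b' e; rewrite -(varE b) -(varE b').
  pose p := Var S (f b); pose q := Var S (f b').
  have eY a : G a -> fn p a = fn q a.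
    move=> Ga; rewrite -repF -[RHS]repF.
    by have := psiE b (exist _ (rep a) (repY a Ga)); rewrite e psiE.
  (* As [K] contains the diagonal of [F], an equality that it forces across the two halves also
     holds throughout [F]. *)
  have forced a a' : (forall z, K z -> z (inl a) = z (inr a')) ->
      G a /\ forall p', fn p' a = fn p' a'.
    move=> h; have h' p' : fn p' a = fn p' a'.
      by apply: (h (join (fn p') (fn p'))); exists p', p'.
    split=> // z Kz; rewrite (h z Kz).
    by case: Kz => p' [q' [-> _]] /=; rewrite h'.
  have [p' [q' [ez epq]]] : K (join (fn p) (fn q)).
    apply: (inv_diagonal hrho hA) => //.
      by exists (join (fn p) (fn p)), p, p.
    move=> [a|a] [a'|a'] h /=.
    + by apply: (h (join (fn p) (fn p))); exists p, p.
    + by have [Ga ha] := forced a a' h; rewrite eY // ha.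
    + have [Ga ha] := forced a' a (fun z Kz => esym (h z Kz)).
      by rewrite -ha eY.
    + by apply: (h (join (fn q) (fn q))); exists q, q.
  have ep : fn p = fn p' by apply/funext => a; exact: (congr1 (@^~ (inl a)) ez).
  have eq : fn q = fn q' by apply/funext => a; exact: (congr1 (@^~ (inr a)) ez).
  by rewrite (fnE _ _ ep) (fnE _ _ eq).
have psi_surj w : exists b, psi b = w.
  have [c _] : exists x : T, True by case: (fcarrier_nonempty A) => x; exists x.
  (* Extending w by classes, with the arbitrary value c off [Y], respects all equalities valid in
     [F], so rigidity puts the result in [F]. *)
  pose x a := odflt c (omap w (insub (rep a) : option Y)).
  have [p ep] : F x.
    apply: (inv_diagonal hrho hA) => //; first by exists (fn (Var _ v0)), (Var _ v0).
    by move=> a a' /rep_eq e; rewrite /x e.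
  exists (eval g p); apply/ffunP => a; rewrite psiE.
  have /andP [/eqP ra /asboolP Ga] := valP a.
  have := Ga (join (fn (Var _ (f (eval g p)))) (fn p)) => /= ->; last first.
    by exists (Var _ (f (eval g p))), p; split=> //; rewrite varE.
  by rewrite -ep /x ra valK.
exists #|Y|; rewrite -card_ffun -[LHS]card_ord.
have /choice [psi' psi'K] := psi_surj.
apply: (bij_eq_card (f := fun k => psi (g k))).
exists (fun w => f (psi' w)) => [k|w]; last by rewrite fK psi'K.
by rewrite (psi_inj _ _ (psi'K (psi (g k)))) gK.
Qed.

Lemma power_spectrum (n : nat) : spectrum A (#|T| ^ n).
Proof.
exists (prod_algebra (fun _ : 'I_n => A : algebra S)); split.
  by move=> K [_ _ KP] KA; apply: KP.
have e : #|{ffun 'I_n -> T}| = #|T| ^ n by rewrite card_ffun card_ord.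
rewrite -e; exists (fun x : 'I_n -> T => enum_rank [ffun i => x i]).
exists (fun k i => (enum_val k : {ffun 'I_n -> T}) i) => [x|k].
  by apply/funext => i; rewrite enum_rankK ffunE.
by rewrite -[RHS]enum_valK; congr enum_rank; apply/ffunP => i; rewrite ffunE.
Qed.

End Spectrum.

Theorem theorem2p64 (S : signature) (A : finAlgebra S)
    (hA : 2 <= #|fcarrier A|)
    (hrho : forall (n : nat) (rho : {set n.-tuple (fcarrier A)}),
        1 <= n ->
        @subuniverse S (power_algebra A n)
          (fun x : n.-tuple (fcarrier A) => x \in rho) ->
        ~ rosenberg rho) :
  minimal_spectrum A.
Proof.
move=> m; split=> [|[n ->]]; first exact: spectrum_power.
exact: power_spectrum.
Qed.
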